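(* Let $X$ be a compact connected Riemann surface of genus $g\geq 2$, realized as $X=\Gamma\backslash\mathbb{H}$ with $\Gamma\subset\mathrm{PSL}_2(\mathbb{R})$ a torsion-free cocompact Fuchsian group, let $\mathcal{B}_X$ be its Bergman kernel and let $r_X$ be its injectivity radius (in the normalization given in the context). Then for every $z\in X$, $$\mathcal{B}_X(z)\;\leq\; \frac{48}{\pi}+\frac{4}{3\pi\sinh^{2}(r_X/4)}.$$
   Context: $\mathbb{H}=\{z=x+\sqrt{-1}\,y\in\mathbb{C}\mid y>0\}$ is the upper half-plane with the hyperbolic metric of constant curvature $-1$ (associated $(1,1)$-form $\frac{\sqrt{-1}}{2}\frac{dz\wedge d\overline z}{\mathrm{Im}(z)^2}$), and $d_{\mathbb{H}}$ is the hyperbolic distance. By uniformization, $X=\Gamma\backslash\mathbb{H}$ with $\Gamma$ acting by fractional linear transformations; points of $X$ are locally identified with points of $\mathbb{H}$. $S_2(\Gamma)$ is the $\mathbb{C}$-vector space of weight-$2$ cusp forms for $\Gamma$ (since $\Gamma$ is cocompact, these are holomorphic $f:\mathbb{H}\to\mathbb{C}$ such that $f(z)\,dz$ is $\Gamma$-invariant), with the Petersson inner product $\langle f,h\rangle=\int_{\Gamma\backslash\mathbb{H}} f(z)\overline{h(z)}\,dx\,dy$, i.e. the inner product $(\alpha,\beta)\mapsto\frac{\sqrt{-1}}{2}\int_X\alpha\wedge\overline{\beta}$ on $H^0(X,K_X)$ under $f\mapsto f\,dz$. Let $\{f_1,\ldots,f_g\}$ be an orthonormal basis of $S_2(\Gamma)$.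 The Bergman kernel of $X$ is $$\mathcal{B}_X(z)=\sum_{j=1}^{g}y^2|f_j(z)|^2,\qquad y=\mathrm{Im}\,z,$$ which is $\Gamma$-invariant, hence a function on $X$, independent of the choice of orthonormal basis. The injectivity radius is defined here as $r_X=\inf\{d_{\mathbb{H}}(z,\gamma z)\mid z\in\mathbb{H},\ \gamma\in\Gamma\setminus\{\mathrm{id}\}\}$. *)

(* Defs.v *)
From mathcomp Require Import all_boot all_order all_algebra.
From mathcomp Require Import complex.
From mathcomp Require Import all_classical all_reals all_analysis.

Set Implicit Arguments.
Unset Strict Implicit.
Unset Printing Implicit Defensive.

Import Order.TTheory GRing.Theory Num.Theory.
Import numFieldNormedType.Exports.
Local Open Scope classical_set_scope.
Local Open Scope ring_scope.
Local Open Scope complex_scope.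
Local Open Scope quotient_scope.

Section HyperbolicPlane.
Context {R : realType}.

Definition sinh (x : R) : R := (expR x - expR (- x)) / 2.

(* The inverse of cosh, for t >= 1. *)
Definition arcosh (t : R) : R := ln (t + Num.sqrt (t ^+ 2 - 1)).

(* R[i]^o, and not R[i], carries the topology (that of the norm). *)
Definition upper_half_plane : set R[i]^o := [set z | 0 < complex.Im z].

(* The distance of the metric |dz|^2 / (Im z)^2, of curvature -1. *)
Definition hdist (z w : R[i]) : R :=
  arcosh (1 + Normc.normc (z - w) ^+ 2 / (2 * complex.Im z * complex.Im w)).

Definition denom (A : 'M[R]_2) (z : R[i]) : R[i] :=
  (A 1 0)%:C * z + (A 1 1)%:C.

Definition moebius (A : 'M[R]_2) (z : R[i]) : R[i] :=
  ((A 0 0)%:C * z + (A 0 1)%:C) / denom A z.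

Lemma denom_neq0 (A : 'M[R]_2) (z : R[i]) :
  \det A = 1 -> upper_half_plane z -> denom A z != 0.
Proof.
move=> dA; rewrite /upper_half_plane /= /denom; case: z => x y /= y_gt0.
rewrite eq_complex /= !(mul0r, subr0, addr0, add0r).
apply/negP => /andP[/eqP re0]; rewrite mulf_eq0 (gt_eqF y_gt0) orbF => /eqP c0.
move: re0; rewrite c0 mul0r add0r => d0.
move: dA; rewrite (expand_det_row _ 1) big_ord_recl big_ord1 /=.
rewrite (_ : lift ord0 ord0 = 1); last exact/val_inj.
by rewrite (_ : ord0 = 0) // c0 d0 !mul0r addr0 => /eqP; rewrite eq_sym oner_eq0.
Qed.

Lemma moebius1 (z : R[i]) : moebius 1 z = z.
Proof.
by rewrite /moebius /denom !mxE /= mul1r mul0r addr0 add0r divr1.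
Qed.

Lemma moebiusM (A B : 'M[R]_2) (z : R[i]) :
    \det A = 1 -> \det B = 1 -> upper_half_plane z ->
  moebius (A * B) z = moebius A (moebius B z).
Proof.
move=> dA dB Hz; have B0 := denom_neq0 dB Hz.
have dAB : \det (A * B) = 1 by rewrite -[A * B]/(A *m B) det_mulmx dA dB mulr1.
have AB0 := denom_neq0 dAB Hz.
have E i : ((A * B) i 0)%:C * z + ((A * B) i 1)%:C =
    (A i 0)%:C * ((B 0 0)%:C * z + (B 0 1)%:C) + (A i 1)%:C * denom B z.
  rewrite -[A * B]/(A *m B) !mxE !big_ord_recl !big_ord0 /=.
  rewrite (_ : lift ord0 ord0 = 1); last exact/val_inj.
  rewrite (_ : ord0 = 0) // /denom !addr0 !(rmorphD, rmorphM) /=.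
  by rewrite !mulrDl !mulrDr !mulrA -!addrA; congr (_ + _); rewrite addrCA.
have F i : (A i 0)%:C * moebius B z + (A i 1)%:C =
    (((A * B) i 0)%:C * z + ((A * B) i 1)%:C) / denom B z.
  by rewrite E mulrDl mulfK // /moebius mulrA.
rewrite [RHS]/moebius /denom !F -/(denom _ z).
by rewrite invfM invrK mulrACA mulVf // mulr1.
Qed.

End HyperbolicPlane.

(* A subgroup of PSL_2(R), given by its full preimage in SL_2(R): a subgroup
   of SL_2(R) stable under A |-> - A. *)
Record psl2_subgroup (R : realType) := Psl2Subgroup {
  psl2_set :> set 'M[R]_2 ;
  psl2_det : forall A, psl2_set A -> \det A = 1 ;
  psl2_1 : psl2_set 1 ;
  psl2_mul : forall A B, psl2_set A -> psl2_set B -> psl2_set (A * B) ;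
  psl2_inv : forall A, psl2_set A -> psl2_set A^-1 ;
  psl2_opp : forall A, psl2_set A -> psl2_set (- A) }.

Section Surface.
Context {R : realType}.
Implicit Types (Γ : psl2_subgroup R) (D : set R[i]).

(* A represents the identity of PSL_2(R). *)
Definition psl2_trivial (A : 'M[R]_2) : Prop := A = 1 \/ A = - 1.

(* Since SL_2(R) -> PSL_2(R) is a covering with finite kernel, a subgroup of
   PSL_2(R) is discrete iff its preimage is. *)
Definition fuchsian Γ : Prop := Γ `<=` isolated Γ.

Definition torsion_free Γ : Prop :=
  forall (A : 'M[R]_2) (n : nat), psl2_set Γ A -> (0 < n)%N ->
    psl2_trivial (A ^+ n) -> psl2_trivial A.

Definition same_orbit Γ (z w : upper_half_plane (R := R)) : bool :=
  `[< exists2 A, psl2_set Γ A & set_val w = moebius A (set_val z) >].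

Lemma same_orbit_equiv Γ : equiv_class_of (same_orbit Γ).
Proof.
have Hv (z : upper_half_plane (R := R)) : upper_half_plane (set_val z).
  exact: set_valP.
split.
- by move=> z; apply/asboolP; exists 1; [exact: psl2_1 | rewrite moebius1].
- have sym (z w : upper_half_plane (R := R)) :
      same_orbit Γ z w -> same_orbit Γ w z.
    move=> /asboolP[A GA e]; apply/asboolP; exists A^-1; first exact: psl2_inv.
    have dA := psl2_det GA; have dV := psl2_det (psl2_inv GA).
    rewrite e -moebiusM // mulVr ?moebius1 //.
    by change (A \in unitmx); rewrite unitmxE dA unitr1.
  by move=> z w; apply/idP/idP; exact: sym.
- move=> w z t /asboolP[A GA e] /asboolP[B GB e'].
  apply/asboolP; exists (B * A); first exact: psl2_mul.
  rewrite e' e moebiusM //; by [exact: psl2_det GA | exact: psl2_det GB].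
Qed.

Canonical same_orbit_equiv_rel Γ := EquivRelPack (same_orbit_equiv Γ).

(* The surface X = Γ\H, as a topological space. *)
Definition surface Γ : topologicalType :=
  quotient_topology {eq_quot same_orbit_equiv_rel Γ}.

Definition cocompact Γ : Prop := compact [set: surface Γ].

Definition injectivity_radius Γ : R :=
  inf [set r | exists z A,
         [/\ upper_half_plane z, psl2_set Γ A, ~ psl2_trivial A
           & r = hdist z (moebius A z)]].

Local Notation dxdy := (lebesgue_measure \x lebesgue_measure)%E.

Definition coords D : set (measurableTypeR R * measurableTypeR R) :=
  [set p | D (p.1 +i* p.2)].

(* Boundary overlaps are allowed, so that both Dirichlet polygons and exact
   sets of representatives qualify. *)
Definition fundamental_domain Γ D : Prop :=
  [/\ measurable (coords D),
      D `<=` upper_half_plane,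
      forall z, upper_half_plane z -> exists2 A, psl2_set Γ A & D (moebius A z)
    & forall A, psl2_set Γ A -> ~ psl2_trivial A ->
        dxdy.-negligible (coords (D `&` moebius A @` D))].

Definition area_integral D (F : R[i] -> R[i]) : R[i] :=
  (\int[dxdy]_(p in coords D) complex.Re (F (p.1 +i* p.2)))%R +i*
  (\int[dxdy]_(p in coords D) complex.Im (F (p.1 +i* p.2)))%R.

(* S_2(Γ); only the values of f on the upper half-plane matter. The second
   condition is the invariance of f(z) dz, as d(Az)/dz = (denom A z)^-2. *)
Definition cusp_form2 Γ (f : R[i] -> R[i]) : Prop :=
  (forall z, upper_half_plane z -> derivable (f : R[i]^o -> R[i]^o) z 1) /\
  (forall A z, psl2_set Γ A -> upper_half_plane z ->
     f (moebius A z) = denom A z ^+ 2 * f z).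

(* The Petersson product, the integral over Γ\H being taken over a
   fundamental domain D. *)
Definition petersson D (f h : R[i] -> R[i]) : R[i] :=
  area_integral D (fun z => f z * (h z)^*).

(* The size g of such a basis of S_2(Γ) = H^0(X, K_X) is the genus of X. Linear
   independence follows from orthonormality. *)
Definition orthonormal_basis Γ D (g : nat) (f : 'I_g -> R[i] -> R[i]) : Prop :=
  [/\ forall j, cusp_form2 Γ (f j),
      forall j k, petersson D (f j) (f k) = (j == k)%:R
    & forall h, cusp_form2 Γ h -> exists c : 'I_g -> R[i],
        forall z, upper_half_plane z -> h z = \sum_(j < g) c j * f j z].

Definition bergman_kernel (g : nat) (f : 'I_g -> R[i] -> R[i]) (z : R[i]) : R :=
  \sum_(j < g) complex.Im z ^+ 2 * Normc.normc (f j z) ^+ 2.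

End Surface.

(* Main.v *)
From HB Require Import structures.
Require Import Defs.
From mathcomp Require Import all_boot all_order all_algebra.
From mathcomp Require Import complex.
From mathcomp Require Import all_classical all_reals all_analysis.
From mathcomp Require Import measurable_realfun ring lra.

Set Implicit Arguments.
Unset Strict Implicit.
Unset Printing Implicit Defensive.

Import Order.TTheory GRing.Theory Num.Theory.
Import numFieldNormedType.Exports.
Local Open Scope classical_set_scope.
Local Open Scope ring_scope.

(** The kernel at [z] is the value of an extremal problem. Let [L] be the sum of
the [|f_j z|^2], so that the kernel is [y^2 * L] with [y = Im z]. The cusp form
[F = sum_j (f_j z)^* f_j] satisfies [F z = L], and its squared norm over a
fundamental domain is also [L], by orthonormality. An upper bound for [|F z|]
in terms of the norm of [F] thus bounds [L] itself.

Such a bound comes from the mean value inequality for the holomorphic function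
[F^2] on a Euclidean square [Q] of centre [z] and half-side [a]:
[pi * a^2 * |F z|^2] is at most the integral of [|F|^2] over [Q]
([square_mean_value]). If no two distinct points of [Q] are in the same orbit,
then [Q] can be moved piece by piece, by elements of the group, into disjoint
parts of the fundamental domain; since [|F|^2 dx dy] is invariant, its integral
over [Q] is at most that over the domain ([unfolding]). Altogether
[pi * a^2 * L^2 <= L].

If [r] is the injectivity radius, [Q] has this property as soon as any two of
its points are at distance less than [r]. As [cosh d(w, v) - 1] is
[|w - v|^2 / (2 Im w Im v)], this holds when [3 a <= 2 (y - a) sinh (r / 2)].
With equality there, [y^2 L <= (1 + 1 / k)^2 / pi] where
[k = 2 sinh (r / 2) / 3], and this is at most
[(2 + 9 / (8 sinh^2 (r / 4))) / pi], which is below the announced bound. The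
argument needs [r > 0], which holds because a torsion-free discrete group moves
every point, locally uniformly, and the quotient is compact.

Two ingredients are proved by elementary means. The mean value inequality
follows from Cauchy's theorem for rectangles (Goursat's bisection, for forms
[P dx + Q dy] differentiable at each point), by integrating over [t] an estimate
on the boundary of the square of half-side [t]. The invariance of the hyperbolic
area is read in the coordinates [x = u e^s], [y = e^s], where the area is
[du ds] and Moebius transformations are composed of shears and reflections, so
that it reduces to Tonelli's theorem and the translation invariance of Lebesgue
measure. *)

(** * Circulation of closed forms around rectangles *)
Section Goursat.
Context {R : realType}.
Implicit Types (P Q : R -> R -> R) (a b c d p q x y w h : R).

Lemma nested_intervals (l r : nat -> R) :
  (forall n, l n <= l n.+1) -> (forall n, r n.+1 <= r n) ->
  (forall n, l n <= r n) -> exists p, forall n, l n <= p <= r n.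
Proof.
move=> lS rS lr.
have ml : {homo l : m n / (m <= n)%N >-> m <= n}.
  exact: homo_leq le_trans lS.
have mr : {homo r : m n / (m <= n)%N >-> n <= m}.
  apply: (@homo_leq _ r (fun x y => y <= x)) => //.
  by move=> x y z yx zx; exact: le_trans zx yx.
have lub n k : l k <= r n.
  have [kn|/ltnW nk] := leqP k n; first exact: le_trans (ml _ _ kn) (lr n).
  exact: le_trans (lr k) (mr _ _ nk).
exists (sup (range l)) => n; apply/andP; split.
  apply: ub_le_sup; last by exists n.
  by exists (r 0%N) => _ [k _ <-]; exact: lub.
apply: ge_sup; first by exists (l 0%N), 0%N.
by move=> _ [k _ <-]; exact: lub.
Qed.

(** Here [(x, y)] is the lower left corner and [u], [v] are the sides. Among the
four quarters of a rectangle one carries at least a quarter of the mass, so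
iterated bisection would produce rectangles with [m / 4 ^+ n <= |K|] shrinking
to a point, against the hypothesis that [K] is there negligible with respect
to the square of the size. *)
Lemma rectangle_bisection (K : R -> R -> R -> R -> R) a c w h :
  0 <= w -> 0 <= h ->
  (forall x y u v, 0 <= u -> 0 <= v -> a <= x -> x + u <= a + w ->
     c <= y -> y + v <= c + h ->
     K x y u v = K x y (u / 2) (v / 2) + K (x + u / 2) y (u / 2) (v / 2) +
       K x (y + v / 2) (u / 2) (v / 2) +
       K (x + u / 2) (y + v / 2) (u / 2) (v / 2)) ->
  (forall p q, a <= p <= a + w -> c <= q <= c + h -> forall e, 0 < e ->
     exists2 d, 0 < d & forall x y u v, a <= x -> x + u <= a + w ->
       c <= y -> y + v <= c + h -> x <= p <= x + u -> y <= q <= y + v ->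
       u < d -> v < d -> `|K x y u v| <= e * (u + v) ^+ 2) ->
  K a c w h = 0.
Proof.
move=> w0 h0 Kadd Kloc; apply/eqP; rewrite -normr_eq0; apply: contraT => Kn0.
have {Kn0} : 0 < `|K a c w h| by rewrite lt_neqAle eq_sym Kn0/=.
set m := `|K a c w h| => m0.
pose W n := w / 2 ^+ n; pose H n := h / 2 ^+ n.
have W0 n : 0 <= W n by rewrite divr_ge0// exprn_ge0.
have H0 n : 0 <= H n by rewrite divr_ge0// exprn_ge0.
have WS n : W n.+1 = W n / 2 by rewrite /W exprS invfM mulrA mulrAC.
have HS n : H n.+1 = H n / 2 by rewrite /H exprS invfM mulrA mulrAC.
pose big n (s : R * R) := m / 4 ^+ n <= `|K s.1 s.2 (W n) (H n)|.
(* the corner of a quarter that still carries its share of [m] *)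
pose next n (s : R * R) : R * R :=
  if big n.+1 s then s else
  if big n.+1 (s.1 + W n.+1, s.2) then (s.1 + W n.+1, s.2) else
  if big n.+1 (s.1, s.2 + H n.+1) then (s.1, s.2 + H n.+1) else
  (s.1 + W n.+1, s.2 + H n.+1).
pose fix S n : R * R := if n is k.+1 then next k (S k) else (a, c).
have nextP n s : exists2 e : bool * bool,
    next n s = (s.1 + e.1%:R * W n.+1, s.2 + e.2%:R * H n.+1) &
    (big n.+1 (next n s) \/ forall e : bool * bool,
      ~~ big n.+1 (s.1 + e.1%:R * W n.+1, s.2 + e.2%:R * H n.+1)).
  rewrite /next; case: ifPn => b1.
    exists (false, false); last by left.
    by rewrite /= !mul0r !addr0; case: (s).
  case: ifPn => b2.
    by exists (true, false); [rewrite /= mul0r mul1r addr0|left].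
  case: ifPn => b3.
    by exists (false, true); [rewrite /= mul0r mul1r addr0|left].
  exists (true, true); first by rewrite /= !mul1r.
  have [b4|b4] := boolP (big n.+1 (s.1 + W n.+1, s.2 + H n.+1)); first by left.
  by right => -[[] []] /=; rewrite ?mul0r ?mul1r ?addr0 //; move: (b1); case: (s).
have SP n : [/\ a <= (S n).1, (S n).1 + W n <= a + w, c <= (S n).2,
    (S n).2 + H n <= c + h & big n (S n)].
  elim: n => [|n [ax xw cy yh bn]].
    by rewrite /big/= /W /H !expr0 !divr1; split.
  have [[e1 e2] eN bb] := nextP n (S n).
  have e01 (e : bool) (u : R) : 0 <= u -> 0 <= e%:R * u / 2 <= u / 2.
    by case: e => u0; rewrite ?mul0r ?mul1r; apply/andP; split => //; lra.
  have bN : big n.+1 (next n (S n)).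
    case: bb => // nb; exfalso.
    have lt4 (e : bool * bool) : `|K ((S n).1 + e.1%:R * W n.+1)
        ((S n).2 + e.2%:R * H n.+1) (W n.+1) (H n.+1)| < m / 4 ^+ n.+1.
      by rewrite ltNge; exact: nb.
    have := lt4 (false, false); have := lt4 (true, false).
    have := lt4 (false, true); have := lt4 (true, true).
    rewrite /= !mul1r !mul0r !addr0 exprS invfM mulrA mulrAC => k1 k2 k3 k4.
    move: bn; rewrite /big Kadd// -WS -HS leNgt => /negP; apply.
    apply: le_lt_trans (ler_normD _ _) _.
    rewrite (_ : m / 4 ^+ n = m / 4 ^+ n / 4 + m / 4 ^+ n / 4 + m / 4 ^+ n / 4 +
      m / 4 ^+ n / 4); last by field; rewrite expf_neq0.
    apply: ltrD => //; apply: le_lt_trans (ler_normD _ _) _.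
    apply: ltrD => //; apply: le_lt_trans (ler_normD _ _) _.
    exact: ltrD.
  move: bN; have := e01 e1 _ (W0 n); have := e01 e2 _ (H0 n).
  rewrite [S n.+1]/= eN/= !WS !HS !mulrA => /andP[? ?] /andP[? ?] bN.
  by split => //; lra.
have SS n : [/\ (S n).1 <= (S n.+1).1, (S n.+1).1 + W n.+1 <= (S n).1 + W n,
    (S n).2 <= (S n.+1).2 & (S n.+1).2 + H n.+1 <= (S n).2 + H n].
  have [[e1 e2] eN _] := nextP n (S n).
  rewrite [S n.+1]/= eN/= WS HS; have := W0 n; have := H0 n.
  by case: e1 eN => _; case: e2 => /= ? ?; rewrite ?mul1r ?mul0r; split; lra.
have [p pP] : exists p, forall n, (S n).1 <= p <= (S n).1 + W n.
  apply: nested_intervals => n; [by case: (SS n)|by case: (SS n)|].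
  by rewrite lerDl.
have [q qP] : exists q, forall n, (S n).2 <= q <= (S n).2 + H n.
  apply: nested_intervals => n; [by case: (SS n)|by case: (SS n)|].
  by rewrite lerDl.
have pR : a <= p <= a + w by have := pP 0%N; rewrite /W expr0 divr1.
have qR : c <= q <= c + h by have := qP 0%N; rewrite /H expr0 divr1.
(* half of what [m] would require at the limit point; 1 avoids a division by 0 *)
pose e := m / (2 * ((w + h) ^+ 2 + 1)).
have e0 : 0 < e.
  by rewrite divr_gt0// mulr_gt0// ltr_pwDr// sqr_ge0.
have [d d0 dP] := Kloc p q pR qR e e0.
have [n nP] : exists n, (w + h) / 2 ^+ n < d.
  exists (Num.bound ((w + h) / d)).
  rewrite ltr_pdivrMr ?exprn_gt0// mulrC -ltr_pdivrMr//.
  have wd0 : 0 <= (w + h) / d by rewrite divr_ge0 ?addr_ge0// ltW.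
  apply: lt_trans (archi_boundP wd0) _.
  by rewrite -natrX ltr_nat ltn_expl.
have [x1 x2 y1 y2] := SP n.
have whn : W n + H n = (w + h) / 2 ^+ n by rewrite /W /H mulrDl.
have Wd : W n < d by apply: le_lt_trans nP; rewrite -whn lerDl.
have Hd : H n < d by apply: le_lt_trans nP; rewrite -whn lerDr.
rewrite /big => mK; have := le_trans mK (dP _ _ _ _ x1 x2 y1 y2 (pP n) (qP n) Wd Hd).
rewrite whn expr_div_n mulrA -exprM mulnC exprM (_ : 2 ^+ 2 = 4 :> R); last by ring.
rewrite ler_pM2r ?invr_gt0 ?exprn_gt0// /e leNgt => /negP; case.
rewrite mulrAC ltr_pdivrMr ?mulr_gt0// ?ltr_pwDr ?sqr_ge0//.
rewrite ltr_pM2l//; have := sqr_ge0 (w + h); lra.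
Qed.

End Goursat.

Section Circulation.
Context {R : realType}.
Implicit Types (P Q f : R -> R -> R) (a b c d p q x y w h A B C e : R).
Local Notation mu := (@lebesgue_measure R).

Definition linear_at f p q A B := forall e, 0 < e ->
  exists2 d, 0 < d & forall x y, `|x - p| < d -> `|y - q| < d ->
    `|f x y - f p q - A * (x - p) - B * (y - q)| <=
      e * (`|x - p| + `|y - q|).

(** The differential form [P dx + Q dy] has mixed derivatives [dP/dy = dQ/dx = B]. *)
Definition closed_at P Q p q :=
  exists A B C, linear_at P p q A B /\ linear_at Q p q B C.

(** The integral of [P dx + Q dy] along the boundary, counterclockwise. *)
Definition circulation P Q a b c d : R :=
  \int[mu]_(x in `[a, b]) (P x c - P x d) +
  \int[mu]_(y in `[c, d]) (Q b y - Q a y).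

Lemma linear_at_continuous f p q A B : linear_at f p q A B ->
  {for p, continuous (f^~ q)} /\ {for q, continuous (f p)}.
Proof.
move=> fL; have key (e : R) : 0 < e -> exists2 d, 0 < d &
    (forall x, `|x - p| < d -> `|f p q - f x q| <= e) /\
    (forall y, `|y - q| < d -> `|f p q - f p y| <= e).
  move=> e0; have [d d0 dP] := fL 1 ltr01.
  pose K := 1 + `|A| + `|B|.
  have K0 : 0 < K by rewrite /K -addrA ltr_pwDl// addr_ge0.
  have eK0 : 0 < e / K by rewrite divr_gt0.
  exists (Num.min d (e / K)); first by rewrite lt_min d0.
  split=> x; rewrite lt_min => /andP[xd xe].
    have := dP x q xd; rewrite subrr normr0 => /(_ d0).
    rewrite mulr0 subr0 addr0 mul1r => fx.
    rewrite distrC (_ : f x q - f p q =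
      (f x q - f p q - A * (x - p)) + A * (x - p)); last by ring.
    apply: le_trans (ler_normD _ _) _; rewrite normrM.
    have : K * `|x - p| <= e by rewrite mulrC -ler_pdivlMr// ltW.
    have : 0 <= `|B| * `|x - p| by rewrite mulr_ge0.
    by rewrite /K !mulrDl mul1r; lra.
  have := dP p x; rewrite subrr normr0 => /(_ d0 xd).
  rewrite mulr0 subr0 add0r mul1r => fx.
  rewrite distrC (_ : f p x - f p q =
    (f p x - f p q - B * (x - q)) + B * (x - q)); last by ring.
  apply: le_trans (ler_normD _ _) _; rewrite normrM.
  have : K * `|x - q| <= e by rewrite mulrC -ler_pdivlMr// ltW.
  have : 0 <= `|A| * `|x - q| by rewrite mulr_ge0.
  by rewrite /K !mulrDl mul1r; lra.
split; apply/(@cvgrPdist_le _ R^o) => e e0; have [d d0 [d1 d2]] := key e e0;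
  near=> x.
- apply: d1; rewrite distrC; near: x; exact: (@cvgr_dist_lt _ R^o).
- apply: d2; rewrite distrC; near: x; exact: (@cvgr_dist_lt _ R^o).
Unshelve. all: by end_near. Qed.

Lemma closed_at_continuous P Q p q : closed_at P Q p q ->
  [/\ {for p, continuous (P^~ q)}, {for q, continuous (P p)},
      {for p, continuous (Q^~ q)} & {for q, continuous (Q p)}].
Proof.
by move=> [A [B [C [/linear_at_continuous[? ?] /linear_at_continuous[? ?]]]]].
Qed.

Lemma continuous_integrable (g : R -> R) a b :
  (forall x, a <= x <= b -> {for x, continuous g}) ->
  mu.-integrable `[a, b] (EFin \o g).
Proof.
move=> gc; apply: continuous_compact_integrable; first exact: segment_compact.
by apply: continuous_in_subspaceT => x; rewrite inE/= in_itv/=; exact: gc.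
Qed.

Lemma Rintegral_segment_cst a b e : a <= b ->
  \int[mu]_(x in `[a, b]) e = e * (b - a).
Proof.
move=> ab; rewrite Rintegral_cst//=; congr (_ * _).
rewrite (lebesgue_measure_itv `[a, b])/= lte_fin.
by case: ltgtP ab => //= -> _; rewrite subrr.
Qed.

Lemma Rintegral_segment_bound (g : R -> R) a b e : a <= b ->
  mu.-integrable `[a, b] (EFin \o g) ->
  (forall x, a <= x <= b -> `|g x| <= e) ->
  `|\int[mu]_(x in `[a, b]) g x| <= e * (b - a).
Proof.
move=> ab gi ge; apply: le_trans (le_normr_Rintegral _ gi) _ => //.
rewrite -Rintegral_segment_cst//.
apply: le_Rintegral => //.
- exact: (integrable_norm gi).
- by apply: continuous_integrable => x _; exact: cvg_cst.
Qed.

Lemma Rintegral_segment_split (g : R -> R) a m b : a <= m -> m <= b ->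
  (forall x, a <= x <= b -> {for x, continuous g}) ->
  \int[mu]_(x in `[a, b]) g x =
  \int[mu]_(x in `[a, m]) g x + \int[mu]_(x in `[m, b]) g x.
Proof.
move=> am mb gc; have gi := continuous_integrable gc.
have gi2 : mu.-integrable `]m, b] (EFin \o g).
  apply: integrableS gi => //=; apply: subset_itv => //; rewrite bnd_simp//.
have := @Rintegral_itvB _ g (BLeft a) (BRight b) m gi.
rewrite !bnd_simp => /(_ am mb); rewrite Rintegral_itv_obnd_cbnd// => <-.
by rewrite addrC subrK.
Qed.

Lemma closed_continuous_horizontal P Q a b u v :
  (forall x, a <= x <= b -> closed_at P Q x u /\ closed_at P Q x v) ->
  forall x, a <= x <= b -> {for x, continuous (fun x => P x u - P x v)}.
Proof.
move=> PQ x /PQ[/closed_at_continuous[? _ _ _] /closed_at_continuous[? _ _ _]].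
exact: (@continuousB _ R^o).
Qed.

Lemma closed_continuous_vertical P Q c d u v :
  (forall y, c <= y <= d -> closed_at P Q u y /\ closed_at P Q v y) ->
  forall y, c <= y <= d -> {for y, continuous (fun y => Q u y - Q v y)}.
Proof.
move=> PQ y /PQ[/closed_at_continuous[_ _ _ ?] /closed_at_continuous[_ _ _ ?]].
exact: (@continuousB _ R^o).
Qed.

(** Closedness along the edges is enough, and this is what allows a rectangle to
be cut around a singularity of the form. *)
Lemma circulation_hsplit P Q a b m c d : a <= m -> m <= b -> c <= d ->
  (forall p q, a <= p <= b -> c <= q <= d ->
     [|| p == a, p == m, p == b, q == c | q == d] -> closed_at P Q p q) ->
  circulation P Q a b c d = circulation P Q a m c d + circulation P Q m b c d.
Proof.
move=> am mb cd PQ; rewrite /circulation (@Rintegral_segment_split _ a m b)//.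
  rewrite (_ : \int[mu]_(y in `[c, d]) (Q b y - Q a y) =
    \int[mu]_(y in `[c, d]) (Q m y - Q a y) +
    \int[mu]_(y in `[c, d]) (Q b y - Q m y)); first by ring.
  rewrite -RintegralD//.
  - by apply: eq_Rintegral => y _; ring.
  - by apply: continuous_integrable; apply: closed_continuous_vertical => y ycd;
      split; apply: PQ => //; rewrite ?eqxx ?orbT ?lexx ?am ?mb ?(le_trans am mb).
  - by apply: continuous_integrable; apply: closed_continuous_vertical => y ycd;
      split; apply: PQ => //; rewrite ?eqxx ?orbT ?lexx ?am ?mb ?(le_trans am mb).
by apply: closed_continuous_horizontal => x xab;
  split; apply: PQ => //; rewrite ?eqxx ?orbT ?lexx ?cd.
Qed.

Lemma circulation_vsplit P Q a b c m d : a <= b -> c <= m -> m <= d ->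
  (forall p q, a <= p <= b -> c <= q <= d ->
     [|| p == a, p == b, q == c, q == m | q == d] -> closed_at P Q p q) ->
  circulation P Q a b c d = circulation P Q a b c m + circulation P Q a b m d.
Proof.
move=> ab cm md PQ; rewrite /circulation.
rewrite (@Rintegral_segment_split (fun y => Q b y - Q a y) c m d)//.
  rewrite (_ : \int[mu]_(x in `[a, b]) (P x c - P x d) =
    \int[mu]_(x in `[a, b]) (P x c - P x m) +
    \int[mu]_(x in `[a, b]) (P x m - P x d)); first by ring.
  rewrite -RintegralD//.
  - by apply: eq_Rintegral => y _; ring.
  - by apply: continuous_integrable; apply: closed_continuous_horizontal => x xab;
      split; apply: PQ => //; rewrite ?eqxx ?orbT ?lexx ?cm ?md ?(le_trans cm md).
  - by apply: continuous_integrable; apply: closed_continuous_horizontal => x xab;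
      split; apply: PQ => //; rewrite ?eqxx ?orbT ?lexx ?cm ?md ?(le_trans cm md).
by apply: closed_continuous_vertical => y ycd;
  split; apply: PQ => //; rewrite ?eqxx ?orbT ?lexx ?ab.
Qed.

(** A closed form with affine coefficients has circulation 0, so only the error
of the affine approximation contributes. *)
Lemma circulation_bound P Q a b c d p q A B C e : a <= b -> c <= d ->
  (forall p q, a <= p <= b -> c <= q <= d -> closed_at P Q p q) ->
  (forall x y, a <= x <= b -> c <= y <= d ->
     `|P x y - P p q - A * (x - p) - B * (y - q)| <= e /\
     `|Q x y - Q p q - B * (x - p) - C * (y - q)| <= e) ->
  `|circulation P Q a b c d| <= 2 * e * ((b - a) + (d - c)).
Proof.
move=> ab cd PQ PQe.
have iP : mu.-integrable `[a, b] (EFin \o (fun x => P x c - P x d)).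
  by apply: continuous_integrable; apply: closed_continuous_horizontal => x xab;
    split; apply: PQ; rewrite ?lexx ?cd.
have iQ : mu.-integrable `[c, d] (EFin \o (fun y => Q b y - Q a y)).
  by apply: continuous_integrable; apply: closed_continuous_vertical => y ycd;
    split; apply: PQ; rewrite ?lexx ?ab.
have ic (k u v : R) : mu.-integrable `[u, v] (EFin \o (fun=> k)).
  by apply: continuous_integrable => y _; exact: cvg_cst.
have -> : circulation P Q a b c d =
    \int[mu]_(x in `[a, b]) (P x c - P x d - B * (c - d)) +
    \int[mu]_(y in `[c, d]) (Q b y - Q a y - B * (b - a)).
  rewrite (RintegralB _ iP (ic _ _ _))// (RintegralB _ iQ (ic _ _ _))//.
  by rewrite !Rintegral_segment_cst// /circulation; ring.
apply: le_trans (ler_normD _ _) _; rewrite [leRHS]mulrDr; apply: lerD.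
  apply: Rintegral_segment_bound => //.
    by have := integrableB _ iP (ic (B * (c - d)) a b); exact.
  move=> x xab.
  have [|/ler_normlP[u1 u2] _] := PQe x c xab; first by rewrite lexx.
  have [|/ler_normlP[v1 v2] _] := PQe x d xab; first by rewrite lexx andbT.
  by apply/ler_normlP; split; lra.
apply: Rintegral_segment_bound => //.
  by have := integrableB _ iQ (ic (B * (b - a)) c d); exact.
move=> y ycd.
have [|_ /ler_normlP[u1 u2]] := PQe a y _ ycd; first by rewrite lexx.
have [|_ /ler_normlP[v1 v2]] := PQe b y _ ycd; first by rewrite lexx andbT.
by apply/ler_normlP; split; lra.
Qed.

(** Goursat's argument: the derivatives need not be continuous, since the
circulation around a small rectangle through [(p, q)] only sees the affine
part of the form at [(p, q)], which is closed, up to an error small with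
respect to the area. *)
Theorem goursat P Q a b c d : a <= b -> c <= d ->
  (forall p q, a <= p <= b -> c <= q <= d -> closed_at P Q p q) ->
  circulation P Q a b c d = 0.
Proof.
move=> ab cd PQ.
have := @rectangle_bisection R (fun x y u v => circulation P Q x (x + u) y (y + v))
  a c (b - a) (d - c).
rewrite /= !subrKC; apply; rewrite ?subr_ge0//.
  move=> x y u v u0 v0 ax xb cy yd.
  have PQ' p q : x <= p <= x + u -> y <= q <= y + v -> closed_at P Q p q.
    by move=> /andP[? ?] /andP[? ?]; apply: PQ; apply/andP; split; lra.
  have xu : x + u / 2 + u / 2 = x + u by field.
  have yv : y + v / 2 + v / 2 = y + v by field.
  rewrite (@circulation_vsplit _ _ _ _ _ (y + v / 2))//; try lra.
  rewrite (@circulation_hsplit _ _ _ _ (x + u / 2) y)//; try lra.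
    rewrite (@circulation_hsplit _ _ _ _ (x + u / 2) (y + v / 2))//; try lra.
      by rewrite xu yv addrA.
    by move=> p q ? /andP[? ?] _; apply: PQ' => //; apply/andP; split; lra.
  by move=> p q ? /andP[? ?] _; apply: PQ' => //; apply/andP; split; lra.
  by move=> p q ? ? _; exact: PQ'.
move=> p q pab qcd e e0; have [A [B [C [PL QL]]]] := PQ p q pab qcd.
have e20 : 0 < e / 2 by rewrite divr_gt0.
have [d1 d10 d1P] := PL _ e20; have [d2 d20 d2P] := QL _ e20.
exists (Num.min d1 d2); first by rewrite lt_min d10.
move=> x y u v ax xb cy yd /andP[xp pu] /andP[yq qv].
rewrite !lt_min => /andP[ud1 ud2] /andP[vd1 vd2].
have -> : e * (u + v) ^+ 2 =
    2 * (e / 2 * (u + v)) * ((x + u - x) + (y + v - y)) by field.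
apply: (@circulation_bound _ _ _ _ _ _ p q A B C); [lra|lra| |].
  by move=> p' q' /andP[? ?] /andP[? ?]; apply: PQ; apply/andP; split; lra.
move=> x' y' /andP[? ?] /andP[? ?].
have xp' : `|x' - p| <= u by apply/ler_normlP; split; lra.
have yq' : `|y' - q| <= v by apply/ler_normlP; split; lra.
have le k : k <= e / 2 * (`|x' - p| + `|y' - q|) -> k <= e / 2 * (u + v).
  by move=> /le_trans; apply; rewrite ler_pM2l// lerD.
by split; apply: le; [apply: d1P|apply: d2P]; apply: le_lt_trans; eassumption.
Qed.
End Circulation.

(** * Complex derivatives in real terms *)
Section ComplexDerivative.
Context {R : realType}.
Local Notation normc := (@Normc.normc R).
Local Notation Re := (@complex.Re R).
Local Notation Im := (@complex.Im R).

Lemma normC_normc (z : R[i]^o) : `|z| = (normc z)%:C%C.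
Proof. by case: z. Qed.

Lemma normc_ge0 (z : R[i]) : 0 <= normc z.
Proof. by case: z => a b; exact: sqrtr_ge0. Qed.

Lemma normc_gt0 (z : R[i]) : (0 < normc z) = (z != 0).
Proof.
rewrite lt_neqAle normc_ge0 andbT eq_sym; congr (~~ _).
by apply/eqP/eqP => [/Normc.eq0_normc|->]; rewrite ?Normc.normc0.
Qed.

Lemma nbhs_complexP (z : R[i]^o) (P : set R[i]^o) :
  nbhs z P <-> exists2 d : R, 0 < d & forall w, normc (w - z) < d -> P w.
Proof.
split=> [/nbhs_ballP[e /= e0 eP]|[d d0 dP]].
  move: (e0); rewrite ltcE => /andP[/eqP /= im re].
  exists (Re e) => // w wz; apply: eP.
  by rewrite -ball_normE /= distrC normC_normc ltcE /= im eqxx.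
apply/nbhs_ballP; exists (d%:C)%C; first by rewrite /= ltcR.
by move=> w; rewrite -ball_normE /= distrC normC_normc ltcR => /dP.
Qed.

Lemma normr_Re_le (z : R[i]) : `|Re z| <= normc z.
Proof.
by case: z => a b /=; rewrite -sqrtr_sqr ler_sqrt ?lerDl ?addr_ge0 ?sqr_ge0.
Qed.

Lemma normr_Im_le (z : R[i]) : `|Im z| <= normc z.
Proof.
by case: z => a b /=; rewrite -sqrtr_sqr ler_sqrt ?lerDr ?addr_ge0 ?sqr_ge0.
Qed.

Lemma normc_le (a b : R) : normc (a +i* b)%C <= `|a| + `|b|.
Proof.
rewrite -(@ler_pXn2r _ 2) ?nnegrE ?sqrtr_ge0 ?addr_ge0//.
rewrite sqr_sqrtr ?addr_ge0 ?sqr_ge0// sqrrD !real_normK ?num_real//.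
by have := mulr_ge0 (normr_ge0 a) (normr_ge0 b); lra.
Qed.

Lemma sqr_normcE (z : R[i]) : normc z ^+ 2 = Re z ^+ 2 + Im z ^+ 2.
Proof. by case: z => a b /=; rewrite sqr_sqrtr ?addr_ge0 ?sqr_ge0. Qed.

Definition cderiv (h : R[i] -> R[i]) (z d : R[i]) := forall e : R, 0 < e ->
  exists2 r : R, 0 < r & forall w, normc (w - z) < r ->
    normc (h w - h z - d * (w - z)) <= e * normc (w - z).

Lemma derivable_cderiv (h : R[i]^o -> R[i]^o) (z : R[i]^o) :
  derivable h z 1 -> exists d, cderiv h z d.
Proof.
move=> /cvg_ex[/= d dP]; exists d => e e0.
move/(@cvgrPdist_le _ _ _ _ _ _ d): dP => /(_ (e%:C)%C).
rewrite ltcR => /(_ e0) /nbhs_complexP[r r0 rP].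
exists r => // w wz; have [->|wNz] := eqVneq w z.
  by rewrite !subrr mulr0 subr0 Normc.normc0 mulr0.
have wz0 : w - z != 0 by rewrite subr_eq0.
have := rP (w - z); rewrite subr0 => /(_ wz wz0).
rewrite normC_normc lecR /= /GRing.scale/= mulr1 subrK => le.
rewrite (_ : h w - h z - d * (w - z) =
  - (d - (w - z)^-1 * (h w - h z)) * (w - z)).
  by rewrite Normc.normcM normcN ler_wpM2r// normc_ge0.
by rewrite mulNr mulrBl mulrAC mulVf// mul1r opprB.
Qed.

(** The form is the real part of [h(z) dz], and its closedness is the system of
Cauchy-Riemann equations. *)
Lemma cderiv_closed_at (h : R[i] -> R[i]) (p q : R) d :
  cderiv h (p +i* q)%C d ->
  closed_at (fun x y => Re (h (x +i* y)%C)) (fun x y => - Im (h (x +i* y)%C)) p q.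
Proof.
move=> hd; exists (Re d), (- Im d), (- Re d).
have key e : 0 < e -> exists2 r : R, 0 < r & forall x y, `|x - p| < r ->
    `|y - q| < r -> normc (h (x +i* y)%C - h (p +i* q)%C -
      d * ((x - p) +i* (y - q))%C) <= e * (`|x - p| + `|y - q|).
  move=> e0; have [r r0 rP] := hd e e0.
  exists (r / 2); first by rewrite divr_gt0.
  move=> x y xp yq; have E : (x +i* y - (p +i* q) = (x - p) +i* (y - q))%C by [].
  have := rP (x +i* y)%C; rewrite E => /(_ _)/le_trans; apply.
    by apply: le_lt_trans (normc_le _ _) _; lra.
  by rewrite ler_pM2l// normc_le.
split=> e e0; have [r r0 rP] := key e e0; exists r => // x y xp yq;
    apply: le_trans (rP x y xp yq); [apply: le_trans (normr_Re_le _)|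
    apply: le_trans (normr_Im_le _)]; case: (d) => d1 d2 /=;
    case: (h (x +i* y)%C) => u v; case: (h (p +i* q)%C) => u' v' /=.
  by rewrite le_eqVlt; apply/orP; left; apply/eqP; congr `|_|; ring.
by rewrite -normrN; rewrite le_eqVlt; apply/orP; left; apply/eqP; congr `|_|; ring.
Qed.

Lemma derivable_closed_at (h : R[i]^o -> R[i]^o) (p q : R) :
  derivable h (p +i* q)%C 1 ->
  closed_at (fun x y => Re (h (x +i* y)%C)) (fun x y => - Im (h (x +i* y)%C)) p q.
Proof. by move=> /derivable_cderiv[d]; exact: cderiv_closed_at. Qed.

Lemma derivable_continuous_coords (h : R[i]^o -> R[i]^o) (F : R[i] -> R) (s : R * R) :
  (forall u v, `|F u - F v| <= normc (u - v)) ->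
  derivable h (s.1 +i* s.2)%C 1 ->
  {for s, continuous (fun s : R * R => F (h (s.1 +i* s.2)%C))}.
Proof.
move=> FL /derivable_cderiv[d hd]; have [r r0 rP] := hd 1 ltr01.
apply/(@cvgrPdist_lt _ R^o) => e e0.
pose K := 1 + normc d; have K0 : 0 < K by rewrite ltr_pwDl// normc_ge0.
have [r20 eK0] : 0 < r / 2 /\ 0 < e / (2 * K) by rewrite !divr_gt0// mulr_gt0.
near=> u; rewrite distrC; apply: le_lt_trans (FL _ _) _.
have [u1 u2] : `|u.1 - s.1| < Num.min (r / 2) (e / (2 * K)) /\
    `|u.2 - s.2| < Num.min (r / 2) (e / (2 * K)).
  split; rewrite distrC; near: u.
    by apply: (@cvgr_dist_lt _ R^o _ _ _ fst); [exact: cvg_fst|rewrite lt_min r20].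
  by apply: (@cvgr_dist_lt _ R^o _ _ _ snd); [exact: cvg_snd|rewrite lt_min r20].
move: u1 u2; rewrite !lt_min => /andP[u1r u1e] /andP[u2r u2e].
set w := (u.1 +i* u.2)%C; set z := (s.1 +i* s.2)%C.
have wz : normc (w - z) <= `|u.1 - s.1| + `|u.2 - s.2| by exact: normc_le.
have wzr : normc (w - z) < r by lra.
have hw := rP w wzr.
rewrite (_ : h w - h z = (h w - h z - d * (w - z)) + d * (w - z)); last by rewrite subrK.
apply: le_lt_trans (le_normcD _ _) _; rewrite Normc.normcM.
have : K * normc (w - z) < e.
  rewrite mulrC -ltr_pdivlMr//; apply: le_lt_trans wz _.
  rewrite (_ : e / K = e / (2 * K) + e / (2 * K)); last by field; rewrite gt_eqF.
  exact: ltrD.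
by rewrite /K mulrDl; lra.
Unshelve. all: by end_near. Qed.

Lemma normc_lipschitz (u v : R[i]) : `|normc u - normc v| <= normc (u - v).
Proof. exact: (@ler_dist_dist R (Rcomplex R) u v). Qed.

Lemma continuous_fst_line (F : R * R -> R) p q : {for (p, q), continuous F} ->
  {for p, continuous (fun x => F (x, q))}.
Proof.
move=> c; apply: (@continuous2_cvg _ _ _ _ _ _ id (fun=> q) (fun x y => F (x, y))).
- have -> : (fun s => F (s.1, s.2)) = F by apply/funext => -[].
  exact: c.
- exact: cvg_id.
- exact: cvg_cst.
Qed.
Lemma continuous_snd_line (F : R * R -> R) p q : {for (p, q), continuous F} ->
  {for q, continuous (fun y => F (p, y))}.
Proof.
move=> c; apply: (@continuous2_cvg _ _ _ _ _ _ (fun=> p) id (fun x y => F (x, y))).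
- have -> : (fun s => F (s.1, s.2)) = F by apply/funext => -[].
  exact: c.
- exact: cvg_cst.
- exact: cvg_id.
Qed.

End ComplexDerivative.

(** * Cauchy's estimate on a square *)
Section SquareMeanValue.
Context {R : realType}.
Implicit Types (P Q : R -> R -> R) (p q t x y M : R).
Local Notation mu := (@lebesgue_measure R).

Lemma circulation_square_bound P Q t M : 0 <= t ->
  (forall x y, -t <= x <= t -> -t <= y <= t ->
    [|| x == - t, x == t, y == - t | y == t] ->
    [/\ closed_at P Q x y, `|P x y| <= M & `|Q x y| <= M]) ->
  `|circulation P Q (- t) t (- t) t| <= 8 * M * t.
Proof.
move=> t0 PQ; have nt : - t <= t by lra.
rewrite (_ : 8 * M * t = (2 * M) * (t - - t) + (2 * M) * (t - - t)); last by ring.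
apply: le_trans (ler_normD _ _) _; apply: lerD.
  apply: Rintegral_segment_bound => //.
    apply: continuous_integrable; apply: closed_continuous_horizontal => x xt.
    by split; apply PQ; rewrite ?eqxx ?orbT ?nt ?lexx.
  move=> x xt; apply: le_trans (ler_normB _ _) _.
  rewrite (_ : 2 * M = M + M); last by ring.
  by apply: lerD; apply PQ; rewrite ?eqxx ?orbT ?nt ?lexx.
apply: Rintegral_segment_bound => //.
  apply: continuous_integrable; apply: closed_continuous_vertical => x xt.
  by split; apply PQ; rewrite ?eqxx ?orbT ?nt ?lexx.
move=> x xt; apply: le_trans (ler_normB _ _) _.
rewrite (_ : 2 * M = M + M); last by ring.
by apply: lerD; apply PQ; rewrite ?eqxx ?orbT ?nt ?lexx.
Qed.

(** The square minus a concentric small one is a union of four rectangles, so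
the circulation equals that around an arbitrarily small square. *)
Lemma goursat_removable P Q t r M : 0 < t -> 0 < r ->
  (forall p q, -t <= p <= t -> -t <= q <= t -> (p != 0) || (q != 0) ->
    closed_at P Q p q) ->
  (forall x y, `|x| < r -> `|y| < r -> (x != 0) || (y != 0) ->
    `|P x y| <= M /\ `|Q x y| <= M) ->
  circulation P Q (- t) t (- t) t = 0.
Proof.
move=> t0 r0 PQ PQM.
(* cut along the lines [x = - e], [x = e], then the middle strip along [y = - e], [y = e] *)
have small e : 0 < e -> e < t -> circulation P Q (- t) t (- t) t =
    circulation P Q (- e) e (- e) e.
  move=> e0 et; have ne0 : - e != 0 by rewrite oppr_eq0 gt_eqF.
  have e0' : e != 0 by rewrite gt_eqF.
  have nt0 : - t != 0 by rewrite oppr_eq0 gt_eqF.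
  have t0' : t != 0 by rewrite gt_eqF.
  have off p q : [|| p == - e, p == e, p == - t | p == t] ||
      [|| q == - e, q == e, q == - t | q == t] -> (p != 0) || (q != 0).
    by case/orP => /or4P[]/eqP ->; rewrite ?ne0 ?e0' ?nt0 ?t0' ?orbT.
  rewrite (@circulation_hsplit _ _ _ _ _ (- e)); try lra; last first.
    by move=> p q ? ? /or4P[|||/orP[]] pq; apply: PQ => //; apply: off;
      rewrite pq ?orbT.
  rewrite (@circulation_hsplit _ _ _ (- e) _ e); try lra; last first.
    move=> p q /andP[? ?] ? /or4P[|||/orP[]] pq; apply: PQ => //;
      [apply/andP; split; lra|apply: off; rewrite pq ?orbT//|
       apply/andP; split; lra|apply: off; rewrite pq ?orbT//|
       apply/andP; split; lra|apply: off; rewrite pq ?orbT//|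
       apply/andP; split; lra|apply: off; rewrite pq ?orbT//|
       apply/andP; split; lra|apply: off; rewrite pq ?orbT//].
  rewrite (@circulation_vsplit _ _ _ (- e) e _ (- e)); try lra; last first.
    move=> p q /andP[? ?] ? /or4P[|||/orP[]] pq; apply: PQ => //;
      [apply/andP; split; lra|apply: off; rewrite pq ?orbT//|
       apply/andP; split; lra|apply: off; rewrite pq ?orbT//|
       apply/andP; split; lra|apply: off; rewrite pq ?orbT//|
       apply/andP; split; lra|apply: off; rewrite pq ?orbT//|
       apply/andP; split; lra|apply: off; rewrite pq ?orbT//].
  rewrite (@circulation_vsplit _ _ _ (- e) e (- e) e); try lra; last first.
    move=> p q /andP[? ?] /andP[? ?] /or4P[|||/orP[]] pq; apply: PQ => //;
      try (apply/andP; split; lra); apply: off; rewrite pq ?orbT//.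
  have nz (p q : R) : p != 0 -> (p != 0) || (q != 0) by move=> ->.
  rewrite (@goursat _ _ _ (- t) (- e)); try lra; last first.
    move=> p q /andP[? ?] ?; apply: PQ => //; first by apply/andP; split; lra.
    by rewrite lt_eqF//; lra.
  rewrite (@goursat _ _ _ e t); try lra; last first.
    move=> p q /andP[? ?] ?; apply: PQ => //; first by apply/andP; split; lra.
    by rewrite gt_eqF//; lra.
  rewrite (@goursat _ _ _ (- e) e (- t) (- e)); try lra; last first.
    move=> p q /andP[? ?] /andP[? ?]; apply: PQ => //;
      try by apply/andP; split; lra.
    by rewrite orbC lt_eqF//; lra.
  rewrite (@goursat _ _ _ (- e) e e t); try lra; last first.
    move=> p q /andP[? ?] /andP[? ?]; apply: PQ => //;
      try by apply/andP; split; lra.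
    by rewrite orbC gt_eqF//; lra.
have M0 : 0 <= M.
  have [|||pM _] := PQM (r / 2) 0; rewrite ?normr0//.
  - by rewrite ger0_norm; lra.
  - by rewrite gt_eqF//; lra.
  - exact: le_trans pM.
apply/eqP; rewrite -normr_le0; apply/ler_addgt0Pl => k k0; rewrite addr0.
pose e := Num.min (Num.min (t / 2) (r / 2)) (k / (8 * (M + 1))).
have k' : 0 < k / (8 * (M + 1)) by rewrite divr_gt0// mulr_gt0//; lra.
have e0 : 0 < e by rewrite !lt_min k' !divr_gt0.
have [et er ek] : [/\ e <= t / 2, e <= r / 2 & e <= k / (8 * (M + 1))].
  by rewrite !ge_min !lexx !orbT.
rewrite (small e)//; last by lra.
have -> : k = 8 * (M + 1) * (k / (8 * (M + 1))).
  by rewrite mulrC divfK// gt_eqF// mulr_gt0//; lra.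
apply: (@le_trans _ _ (8 * M * e)); last first.
  by apply: ler_pM => //; [lra|exact: ltW|lra].
apply: circulation_square_bound; first exact: ltW.
move=> x y /andP[? ?] /andP[? ?] xy.
have nz : (x != 0) || (y != 0).
  by case/or4P: xy => /eqP ->; rewrite ?oppr_eq0 (gt_eqF e0) ?orbT.
have [] := PQM x y _ _ nz; [by apply/ltr_normlP; split; lra|
  by apply/ltr_normlP; split; lra|].
by move=> ? ?; split => //; apply: PQ => //; apply/andP; split; lra.
Qed.

(** Twice the angle [pi / 2] under which a side of the square is seen from its
centre. *)
Lemma integral_angle t : 0 < t ->
  \int[mu]_(x in `[- t, t]) (2 * t / (x ^+ 2 + t ^+ 2)) = pi.
Proof.
move=> t0.
pose F x : R := 2 * atan (x / t).
have dF x : is_derive x (1 : R) F (2 * t / (x ^+ 2 + t ^+ 2)).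
  have dx : is_derive x (1 : R) (fun x => x / t) t^-1.
    rewrite (_ : (fun x => x / t) = t^-1 *: id); last first.
      by apply/funext => u /=; rewrite mulrC.
    by apply: is_derive_eq; rewrite /GRing.scale/= mulr1.
  have da := is_derive1_atan (x / t).
  have dc := @is_derive1_comp _ atan (fun x => x / t) x _ _ da dx.
  have -> : F = 2 *: (atan \o (fun x => x / t)) by [].
  apply: is_derive_eq; rewrite /GRing.scale/=; field.
  by apply/andP; split; rewrite gt_eqF// ltr_wpDl ?sqr_ge0 ?exprn_gt0.
have cf : forall x, {for x, continuous (fun x => 2 * t / (x ^+ 2 + t ^+ 2))}.
  move=> x; apply: (@continuousM _ R^o); first exact: cvg_cst.
  apply: (@continuousV _ R^o); first by rewrite gt_eqF// ltr_wpDl ?sqr_ge0 ?exprn_gt0.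
  by apply: (@continuousD _ R^o); [exact: exprn_continuous|exact: cvg_cst].
pose f x : R := 2 * t / (x ^+ 2 + t ^+ 2).
have cw : {within `[- t, t], continuous f}.
  by apply: continuous_in_subspaceT => x _; exact: cf.
have cF x : {for x, continuous F}.
  apply: (@differentiable_continuous _ R^o R^o); apply/derivable1_diffP.
  exact: ex_derive.
have E : (\int[mu]_(x in `[(- t)%R, t]) (f x)%:E = (F t)%:E - (F (- t)%R)%:E)%E.
  apply: (@continuous_FTC2 _ f F) => //; first by lra.
    split=> [x _||]; first exact: ex_derive.
      by apply: cvg_at_right_filter; exact: cF.
    by apply: cvg_at_left_filter; exact: cF.
  by move=> x _; rewrite derive1E derive_val.
by rewrite /Rintegral E -EFinB/= /F mulNr divff ?gt_eqF// atanN atan1; field.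
Qed.
End SquareMeanValue.

Section CauchySquare.
Context {R : realType}.
Local Notation normc := (@Normc.normc R).
Local Notation Re := (@complex.Re R).
Local Notation Im := (@complex.Im R).
Local Notation mu := (@lebesgue_measure R).
Implicit Types (t x y : R).

Lemma derivable_quotient_at0 (h : R[i]^o -> R[i]^o) (k c w : R[i]^o) :
  derivable h w 1 -> w != 0 ->
  derivable ((fun w => k * (h w - c) / w) : R[i]^o -> R[i]^o) w 1.
Proof.
move=> hw w0.
have dc : derivable (h - cst c : R[i]^o -> R[i]^o) w 1.
  exact: (@derivableB _ _ _ h (cst c) w 1 hw (derivable_cst _ _ _)).
have di : derivable (id : R[i]^o -> R[i]^o) w 1 by exact: derivable_id.
have dV := @derivableV _ _ id w 1 w0 di.
have dk := @derivableM _ _ (cst k) _ w 1 (derivable_cst _ _ _) dc.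
exact: (@derivableM _ _ _ _ w 1 dk dV).
Qed.

(** The quotient [g w = k * (h w - h 0) / w] is bounded near 0, so the real part
of [g(w) dw] has circulation 0. With [k] chosen so that [k * h 0] is
[- i * |h 0|], the part of the form coming from [h 0] is [- |h 0|] times the
angular form, of circulation [- 2 pi |h 0|], and the remaining part is at most
[|h w| / t] on the boundary. *)
Lemma cauchy_square (h : R[i]^o -> R[i]^o) t : 0 < t ->
  (forall x y, -t <= x <= t -> -t <= y <= t -> derivable h (x +i* y)%C 1) ->
  2 * pi * t * normc (h 0) <=
  \int[mu]_(x in `[- t, t])
    (normc (h (x +i* (- t))%C) + normc (h (x +i* t)%C)) +
  \int[mu]_(y in `[- t, t])
    (normc (h (t +i* y)%C) + normc (h ((- t) +i* y)%C)).
Proof.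
move=> t0 hd; pose H := normc (h 0).
have [k kh0 k1] : exists2 k : R[i], k * h 0 = - 'i%C * (H%:C)%C & normc k <= 1.
  exists (- 'i%C * (H%:C)%C / h 0).
    have [h00|h00] := eqVneq (h 0) 0; last by rewrite divfK.
    by rewrite /H h00 Normc.normc0 !mulr0.
  rewrite 2!Normc.normcM normcN Normc.normcV.
  have -> : normc (H%:C)%C = H.
    by rewrite /= expr0n addr0 sqrtr_sqr ger0_norm// normc_ge0.
  have -> : normc 'i%C = 1 by rewrite /= expr0n expr1n add0r sqrtr1.
  rewrite mul1r -/H; have [->|H0] := eqVneq H 0; first by rewrite mul0r.
  by rewrite divff.
pose g (w : R[i]) := k * (h w - h 0) / w.
pose P x y := Re (g (x +i* y)%C); pose Q x y := - Im (g (x +i* y)%C).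
have t00 : -t <= 0 <= t by apply/andP; split; lra.
have nz x y : (x != 0) || (y != 0) -> (x +i* y)%C != 0.
  by rewrite eq_complex/= negb_and.
have PQ x y : -t <= x <= t -> -t <= y <= t -> (x != 0) || (y != 0) ->
    closed_at P Q x y.
  move=> xt yt xy0; apply: (@derivable_closed_at R g).
  by apply: derivable_quotient_at0; [exact: hd|exact: nz].
have circ0 : circulation P Q (- t) t (- t) t = 0.
  have [d hd0] := derivable_cderiv (hd 0 0 t00 t00).
  have [r r0 rP] := hd0 1 ltr01.
  apply: (@goursat_removable R P Q t (r / 2) (1 + normc d)) => //.
    by rewrite divr_gt0.
  move=> x y xr yr xy0.
  have gb : normc (g (x +i* y)%C) <= 1 + normc d.
    have w0 := nz _ _ xy0; set w := (x +i* y)%C in w0 *.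
    have nw0 : 0 < normc w by rewrite normc_gt0.
    have wr : normc (w - 0) < r.
      by rewrite subr0; apply: le_lt_trans (normc_le _ _) _; lra.
    have := rP w wr; rewrite subr0 mul1r => hw.
    rewrite /g !Normc.normcM Normc.normcV ler_pdivrMr//.
    apply: (@le_trans _ _ (normc (h w - h 0))).
      by rewrite ler_piMl// normc_ge0.
    rewrite -[h w - h 0](subrK (d * w)); apply: le_trans (le_normcD _ _) _.
    by rewrite Normc.normcM mulrDl mul1r lerD2r.
  by split; [apply: le_trans (normr_Re_le _) gb|
    rewrite normrN; apply: le_trans (normr_Im_le _) gb].
have angle x y : (x != 0) || (y != 0) ->
    P x y = Re (k * h (x +i* y)%C / (x +i* y)%C) + H * y / (x ^+ 2 + y ^+ 2) /\
    Q x y = - Im (k * h (x +i* y)%C / (x +i* y)%C) - H * x / (x ^+ 2 + y ^+ 2).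
  move=> xy0; rewrite /P /Q /g mulrBr kh0 mulrBl.
  by case: (k * h (x +i* y)%C / (x +i* y)%C) => a b /=; split; ring.
have small x y : t <= normc (x +i* y)%C ->
    normc (k * h (x +i* y)%C / (x +i* y)%C) <= t^-1 * normc (h (x +i* y)%C).
  move=> tw; rewrite !Normc.normcM Normc.normcV mulrC.
  apply: ler_pM; rewrite ?invr_ge0 ?mulr_ge0 ?normc_ge0//.
    by rewrite lef_pV2// ?posrE// (lt_le_trans t0).
  by rewrite ler_piMl// normc_ge0.
have far x y : (`|x| == t) || (`|y| == t) -> t <= normc (x +i* y)%C.
  by case/orP => /eqP <-; [exact: (normr_Re_le (x +i* y)%C)|exact: (normr_Im_le (x +i* y)%C)].
have tt : `|t| = t by rewrite gtr0_norm.
have nt0 : - t != 0 by rewrite oppr_eq0 gt_eqF.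
have t0' : t != 0 by rewrite gt_eqF.
have ntt : - t <= - t <= t by apply/andP; split; lra.
have ttt : - t <= t <= t by apply/andP; split; lra.
pose A x := normc (h (x +i* (- t))%C) + normc (h (x +i* t)%C).
pose B y := normc (h (t +i* y)%C) + normc (h ((- t) +i* y)%C).
have c1 x y : -t <= x <= t -> -t <= y <= t ->
    {for x, continuous (fun x => normc (h (x +i* y)%C))}.
  move=> xt yt.
  have := derivable_continuous_coords (s := (x, y)) (@normc_lipschitz R) (hd _ _ xt yt).
  exact: continuous_fst_line.
have c2 x y : -t <= x <= t -> -t <= y <= t ->
    {for y, continuous (fun y => normc (h (x +i* y)%C))}.
  move=> xt yt.
  have := derivable_continuous_coords (s := (x, y)) (@normc_lipschitz R) (hd _ _ xt yt).
  exact: continuous_snd_line.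
have iA : mu.-integrable `[- t, t] (EFin \o A).
  by apply: continuous_integrable => x xt; apply: (@continuousD _ R^o); exact: c1.
have iB : mu.-integrable `[- t, t] (EFin \o B).
  by apply: continuous_integrable => x xt; apply: (@continuousD _ R^o); exact: c2.
pose T x : R := 2 * t / (x ^+ 2 + t ^+ 2).
have iT : mu.-integrable `[- t, t] (EFin \o T).
  apply: continuous_integrable => x _.
  apply: (@continuousM _ R^o); first exact: cvg_cst.
  apply: (@continuousV _ R^o); first by rewrite gt_eqF// ltr_wpDl ?sqr_ge0 ?exprn_gt0.
  by apply: (@continuousD _ R^o); [exact: exprn_continuous|exact: cvg_cst].
have bound (f S : R -> R) : mu.-integrable `[- t, t] (EFin \o f) ->
    mu.-integrable `[- t, t] (EFin \o S) ->
    (forall x, -t <= x <= t -> f x <= t^-1 * S x - H * T x) ->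
    \int[mu]_(x in `[- t, t]) f x <=
      t^-1 * \int[mu]_(x in `[- t, t]) S x - H * pi.
  move=> fi Si fS; rewrite -(integral_angle t0) -!RintegralZl//.
  have iS' : mu.-integrable `[- t, t] (EFin \o (fun x => t^-1 * S x)).
    by have := integrableZl _ t^-1 Si; exact.
  have iT' : mu.-integrable `[- t, t] (EFin \o (fun x => H * T x)).
    by have := integrableZl _ H iT; exact.
  rewrite -(RintegralB _ iS' iT')//; apply: le_Rintegral => //.
  by have := integrableB _ iS' iT'; exact.
have hb : \int[mu]_(x in `[- t, t]) (P x (- t) - P x t) <=
    t^-1 * \int[mu]_(x in `[- t, t]) A x - H * pi.
  apply: bound => //.
    apply: continuous_integrable; apply: closed_continuous_horizontal => x xt.
    by split; apply: PQ; rewrite ?nt0 ?t0' ?orbT.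
  move=> x xt; have [|-> _] := angle x (- t); first by rewrite nt0 orbT.
  have [|-> _] := angle x t; first by rewrite t0' orbT.
  have f1 : t <= normc (x +i* (- t))%C by rewrite far// normrN tt eqxx orbT.
  have f2 : t <= normc (x +i* t)%C by rewrite far// tt eqxx orbT.
  have /ler_normlP[_ ?] := le_trans (normr_Re_le _) (small _ _ f1).
  have /ler_normlP[? _] := le_trans (normr_Re_le _) (small _ _ f2).
  by rewrite /A /T sqrrN; lra.
have vb : \int[mu]_(y in `[- t, t]) (Q t y - Q (- t) y) <=
    t^-1 * \int[mu]_(y in `[- t, t]) B y - H * pi.
  apply: bound => //.
    apply: continuous_integrable; apply: closed_continuous_vertical => y yt.
    by split; apply: PQ; rewrite ?nt0 ?t0'.
  move=> y yt; have [|_ ->] := angle (- t) y; first by rewrite nt0.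
  have [|_ ->] := angle t y; first by rewrite t0'.
  have f1 : t <= normc ((- t) +i* y)%C by rewrite far// normrN tt eqxx.
  have f2 : t <= normc (t +i* y)%C by rewrite far// tt eqxx.
  have /ler_normlP[_ ?] := le_trans (normr_Im_le _) (small _ _ f1).
  have /ler_normlP[? _] := le_trans (normr_Im_le _) (small _ _ f2).
  by rewrite /B /T sqrrN [t ^+ 2 + _]addrC; lra.
have := lerD hb vb; rewrite -/(circulation P Q (- t) t (- t) t) circ0.
rewrite addrACA -mulrDr -opprD -mulrDr subr_ge0 => le.
rewrite -[leRHS](mulVKf t0') (_ : 2 * pi * t * H = t * (H * (pi + pi))); last by ring.
by rewrite ler_pM2l.
Qed.
End CauchySquare.

(** * Lebesgue measure on the plane *)
Section PlaneMeasure.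
Context {R : realType}.
Local Notation mu := (@lebesgue_measure R).
Local Notation plane := (measurableTypeR R * measurableTypeR R)%type.

(** The measurable sets of the plane are generated by products, and an open set is
a countable union of boxes with rational centres. *)
Lemma open_measurable_plane (O : set (R * R)) :
  open O -> measurable (O : set plane).
Proof.
move=> oO; pose box (i : rat * rat * nat) : set plane :=
  [set` `](ratr i.1.1 - i.2.+1%:R^-1 : R), (ratr i.1.1 + i.2.+1%:R^-1)[] `*`
  [set` `](ratr i.1.2 - i.2.+1%:R^-1 : R), (ratr i.1.2 + i.2.+1%:R^-1)[].
rewrite [X in measurable X](_ : _ =
    \bigcup_i (if `[< box i `<=` O >] then box i else set0)); last first.
  apply/seteqP; split => p; last first.
    by move=> [i _]; case: ifPn => // /asboolP; exact.
  move=> Op; have : nbhs p O by exact: open_nbhs_nbhs.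
  move=> /nbhs_ballP[e /= e0 eO].
  pose n := Num.bound (2 / e).
  have n1 : n.+1%:R^-1 < e / 2 :> R.
    rewrite invf_plt ?posrE ?divr_gt0// invf_div.
    have := @archi_boundP R (2 / e); rewrite divr_ge0 ?ltW// => /(_ isT) /lt_trans; apply.
    by rewrite ltr_nat.
  have n0 : 0 < n.+1%:R^-1 :> R by rewrite invr_gt0.
  have [k kE] : exists k : R, n.+1%:R^-1 = k by exists n.+1%:R^-1.
  rewrite kE in n0 n1.
  have approx (x : R) : exists q : rat, `|x - ratr q| < k.
    have [|q] := @rat_in_itvoo R (x - k) (x + k); first by lra.
    rewrite in_itv/= => /andP[? ?]; exists q; apply/ltr_normlP; split; lra.
  have [q1 /ltr_normlP[? ?]] := approx p.1.
  have [q2 /ltr_normlP[? ?]] := approx p.2.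
  have pbox : box (q1, q2, n) p.
    by rewrite /box/= kE; split => /=; rewrite in_itv/=; apply/andP; split; lra.
  exists (q1, q2, n) => //.
  case: ifPn => // /asboolPn; case => r -[/=]; rewrite !in_itv/= kE => /andP[? ?] /andP[? ?].
  apply: eO; split; rewrite /ball/= /ball_/=; apply/ltr_normlP; split; lra.
apply: countable_bigcupT_measurable => // i; case: ifPn => // _.
by apply: measurableX; exact: measurable_itv.
Qed.

Lemma open_upper : open ([set p | 0 < p.2] : set (R * R)).
Proof.
suff : open ((snd : R * R -> R) @^-1` [set x | 0 < x]) by [].
by apply: open_comp; [move=> p _; exact: cvg_snd|exact: open_gt].
Qed.

Lemma measurable_upper : measurable ([set p | 0 < p.2] : set plane).
Proof. by apply: open_measurable_plane; exact: open_upper. Qed.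

Lemma continuous_measurable_plane (O : set (R * R)) (F : R * R -> R) :
  open O -> (forall p, O p -> {for p, continuous F}) ->
  measurable_fun (O : set plane) (F : plane -> measurableTypeR R).
Proof.
move=> oO cF; apply: (measurability _ (RGenOInfty.measurableE R)).
move=> /= _ [_ [a ->] <-]; apply: open_measurable_plane.
rewrite openE => p [Op Fp]; apply: filterI; first exact: open_nbhs_nbhs.
apply: (cF p Op); apply: open_nbhs_nbhs; split => //; exact: interval_open.
Qed.

Lemma ge0_integral_affine (c b : R) (f : R -> \bar R) : 0 < c ->
  measurable_fun [set: R] f -> (forall x, 0 <= f x)%E ->
  (\int[mu]_x f x = c%:E * \int[mu]_x f (c * x + b)%R)%E.
Proof.
move=> c0 mf f0; pose phi (x : measurableTypeR R) : measurableTypeR R := c * x + b.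
have mphi : measurable_fun setT phi.
  by apply: measurable_funD => //; exact: measurable_funM.
pose p : {measure set (measurableTypeR R) -> \bar R} := pushforward mu phi.
pose m : {measure set (measurableTypeR R) -> \bar R} :=
  mscale (NngNum (ltW c0)) (p mphi).
have E A : measurable A -> mu A = m A.
  apply: lebesgue_measure_unique => _ [[x1 x2]] _ <-.
  rewrite /m/= /mscale/= /pushforward/=.
  rewrite (_ : phi @^-1` _ = [set` `](x1 - b) / c, (x2 - b) / c]]); last first.
    apply/seteqP; split=> x /=; rewrite !in_itv/= /phi ltr_pdivrMr// ler_pdivlMr// mulrC;
      by move=> /andP[? ?]; apply/andP; split; lra.
  rewrite !lebesgue_measure_itv/= !lte_fin ltr_pM2r ?invr_gt0// ltrD2r.
  case: ifPn => _; last by rewrite mule0.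
  by rewrite -EFinB -EFinM; congr (_%:E); field; rewrite gt_eqF.
transitivity (\int[m]_x f x)%E.
  by apply: eq_measure_integral => A mA _; exact: E.
rewrite /m ge0_integral_mscale//=; congr (_ * _)%E.
by rewrite ge0_integral_pushforward// preimage_setT.
Qed.

Lemma ge0_integral_translate (b : R) (f : R -> \bar R) :
  measurable_fun [set: R] f -> (forall x, 0 <= f x)%E ->
  (\int[mu]_x f x = \int[mu]_x f (x + b)%R)%E.
Proof.
move=> mf f0; rewrite (@ge0_integral_affine 1 b)// mul1e.
by apply: eq_integral => x _; rewrite mul1r.
Qed.

Lemma ge0_integral_reflect (f : R -> \bar R) :
  measurable_fun [set: R] f -> (forall x, 0 <= f x)%E ->
  (\int[mu]_x f x = \int[mu]_x f (- x)%R)%E.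
Proof.
move=> mf f0; transitivity (\int[pushforward mu (-%R : _ -> measurableTypeR R)]_x f x)%E.
  by apply: eq_measure_integral => A mA _; exact/esym/lebesgue_measureN.
by rewrite ge0_integral_pushforward// preimage_setT.
Qed.

End PlaneMeasure.

(** * Area preserving maps of the plane *)
Section PlaneTransformations.
Context {R : realType}.
Local Notation mu := (@lebesgue_measure R).
Local Notation plane := (measurableTypeR R * measurableTypeR R)%type.
Local Notation area := (@lebesgue_measure R \x @lebesgue_measure R)%E.
Implicit Types (m : R * R -> R * R) (b : R -> R).

Definition area_preserving m := measurable_fun setT (m : plane -> plane) /\
  forall f : plane -> \bar R, measurable_fun setT f -> (forall p, 0 <= f p)%E ->
  (\int[area]_p f (m p) = \int[area]_p f p)%E.

Lemma area_preserving_comp m1 m2 :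
  area_preserving m1 -> area_preserving m2 -> area_preserving (m1 \o m2).
Proof.
move=> [mm1 p1] [mm2 p2]; split; first exact: measurableT_comp mm1 mm2.
move=> f mf f0; transitivity (\int[area]_p f (m1 p))%E; last exact: p1.
have mfm := measurableT_comp mf mm1.
by apply: (p2 _ mfm) => p; exact: f0.
Qed.

Lemma area_preserving_fiber1 (g : R -> R -> R) :
  measurable_fun setT (fun p : plane => g p.1 p.2 : measurableTypeR R) ->
  (forall (y : R) (f : R -> \bar R), measurable_fun [set: R] f ->
    (forall x, 0 <= f x)%E -> (\int[mu]_x f (g x y) = \int[mu]_x f x)%E) ->
  area_preserving (fun p => (g p.1 p.2, p.2)).
Proof.
move=> mg gint.
have mm : measurable_fun setT ((fun p => (g p.1 p.2, p.2)) : plane -> plane).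
  by apply: measurable_fun_pair.
split=> // f mf f0; rewrite !fubini_tonelli2//; last exact: measurableT_comp mf mm.
apply: eq_integral => y _; rewrite /fubini_G/= (gint y (fun x => f (x, y)))//.
exact: measurableT_comp mf (pair2_measurable _).
Qed.

Lemma area_preserving_fiber2 (g : R -> R -> R) :
  measurable_fun setT (fun p : plane => g p.1 p.2 : measurableTypeR R) ->
  (forall (x : R) (f : R -> \bar R), measurable_fun [set: R] f ->
    (forall y, 0 <= f y)%E -> (\int[mu]_y f (g x y) = \int[mu]_y f y)%E) ->
  area_preserving (fun p => (p.1, g p.1 p.2)).
Proof.
move=> mg gint.
have mm : measurable_fun setT ((fun p => (p.1, g p.1 p.2)) : plane -> plane).
  by apply: measurable_fun_pair.
split=> // f mf f0; rewrite !fubini_tonelli1//; last exact: measurableT_comp mf mm.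
apply: eq_integral => x _; rewrite /fubini_F/= (gint x (fun y => f (x, y)))//.
exact: measurableT_comp mf (pair1_measurable _).
Qed.

Lemma area_preserving_shear1 b : measurable_fun setT b ->
  area_preserving (fun p => (p.1 + b p.2, p.2)).
Proof.
move=> mb; apply: (area_preserving_fiber1 (g := fun x y => x + b y)).
  by apply: measurable_funD => //; exact: measurableT_comp mb measurable_snd.
by move=> y f mf f0; rewrite -ge0_integral_translate.
Qed.

Lemma area_preserving_shear2 b : measurable_fun setT b ->
  area_preserving (fun p => (p.1, p.2 + b p.1)).
Proof.
move=> mb; apply: (area_preserving_fiber2 (g := fun x y => y + b x)).
  by apply: measurable_funD => //; exact: measurableT_comp mb measurable_fst.
by move=> y f mf f0; rewrite -ge0_integral_translate.
Qed.

Lemma area_preserving_opp : area_preserving (fun p => (- p.1, - p.2)).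
Proof.
have mo1 : measurable_fun setT (fun p : plane => - p.1 : measurableTypeR R).
  by apply: measurable_funN.
have mo2 : measurable_fun setT (fun p : plane => - p.2 : measurableTypeR R).
  by apply: measurable_funN.
apply: (@area_preserving_comp (fun p => (- p.1, p.2)) (fun p => (p.1, - p.2))).
  apply: (area_preserving_fiber1 (g := fun x y => - x)) => //.
  by move=> y f mf f0; rewrite -ge0_integral_reflect.
apply: (area_preserving_fiber2 (g := fun x y => - y)) => //.
by move=> y f mf f0; rewrite -ge0_integral_reflect.
Qed.

Lemma ge0_integral_mrestr d (T : measurableType d)
    (m : {measure set T -> \bar R}) (D : set T) (mD : measurable D)
    (f : T -> \bar R) : measurable_fun setT f -> (forall x, 0 <= f x)%E ->
  (\int[mrestr m mD]_x f x = \int[m]_(x in D) f x)%E.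
Proof.
move=> mf f0; rewrite (@ge0_negligible_integral _ _ _ _ setT (~` D))//; last 2 first.
- exact: measurableC.
- by rewrite /= /mrestr setICl measure0.
rewrite setTD setCK; apply: eq_measure_integral => A mA AD.
by rewrite /= /mrestr setIidl.
Qed.

End PlaneTransformations.

(** * The mean value inequality on a square *)
Section AreaMeanValue.
Context {R : realType}.
Local Notation normc := (@Normc.normc R).
Local Notation mu := (@lebesgue_measure R).
Local Notation plane := (measurableTypeR R * measurableTypeR R)%type.
Local Notation area := (@lebesgue_measure R \x @lebesgue_measure R)%E.
Implicit Types (t x y a : R).

Definition square a : set (R * R) := [set p | `|p.1| < a /\ `|p.2| < a].

Lemma open_square a : open (square a).
Proof.
have o1 : open ((fun p : R * R => `|p.1|) @^-1` [set x | x < a]).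
  apply: open_comp; last exact: open_lt.
  by move=> p _; apply: cvg_norm; exact: cvg_fst.
have o2 : open ((fun p : R * R => `|p.2|) @^-1` [set x | x < a]).
  apply: open_comp; last exact: open_lt.
  by move=> p _; apply: cvg_norm; exact: cvg_snd.
exact: openI o1 o2.
Qed.

Lemma measurable_square a : measurable (square a : set plane).
Proof. by apply: open_measurable_plane; exact: open_square. Qed.

Lemma cauchy_square_ereal (h : R[i]^o -> R[i]^o) t : 0 < t ->
  (forall x y, -t <= x <= t -> -t <= y <= t -> derivable h (x +i* y)%C 1) ->
  ((2 * pi * t * normc (h 0))%:E <=
  (\int[mu]_(x in `[(- t)%R, t]) (normc (h (x +i* (- t))%C))%:E +
   \int[mu]_(x in `[(- t)%R, t]) (normc (h (x +i* t)%C))%:E) +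
  (\int[mu]_(y in `[(- t)%R, t]) (normc (h (t +i* y)%C))%:E +
   \int[mu]_(y in `[(- t)%R, t]) (normc (h ((- t) +i* y)%C))%:E))%E.
Proof.
move=> t0 hd.
have ntt : - t <= - t <= t by apply/andP; split; lra.
have ttt : - t <= t <= t by apply/andP; split; lra.
have cont x y : -t <= x <= t -> -t <= y <= t ->
    {for (x, y), continuous (fun s : R * R => normc (h (s.1 +i* s.2)%C))}.
  move=> xt yt; apply: derivable_continuous_coords (hd _ _ xt yt).
  exact: normc_lipschitz.
have ci1 y : -t <= y <= t ->
    mu.-integrable `[- t, t] (EFin \o (fun x => normc (h (x +i* y)%C))).
  move=> yt; apply: continuous_integrable => x xt.
  exact: continuous_fst_line (cont x y xt yt).
have ci2 x : -t <= x <= t ->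
    mu.-integrable `[- t, t] (EFin \o (fun y => normc (h (x +i* y)%C))).
  move=> xt; apply: continuous_integrable => y yt.
  exact: continuous_snd_line (cont x y xt yt).
have := cauchy_square t0 hd; rewrite !RintegralD//; try exact: ci1; try exact: ci2.
rewrite -lee_fin 3!EFinD /Rintegral !fineK//; apply: integrable_fin_num => //;
  by [exact: ci1|exact: ci2].
Qed.

(** The estimate on the boundary of the square of half-side [t], integrated over
[0 < t < a]. The horizontal edges sweep the part [V] of the square where
[|x| <= |y|], the vertical ones the complementary part [W]; the parameters [t]
and [- t] give opposite edges. *)
Lemma square_mean_value (h : R[i]^o -> R[i]^o) a : 0 < a ->
  (forall x y, `|x| < a -> `|y| < a -> derivable h (x +i* y)%C 1) ->
  ((pi * a ^+ 2 * normc (h 0))%:E <=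
   \int[area]_(p in square a) (normc (h (p.1 +i* p.2)%C))%:E)%E.
Proof.
move=> a0 hd.
pose g (p : plane) : \bar R := (normc (h (p.1 +i* p.2)%C))%:E.
have mQ := measurable_square a.
have mg : measurable_fun (square a : set plane) g.
  apply/measurable_EFinP; apply: continuous_measurable_plane; first exact: open_square.
  move=> p [p1 p2]; apply: derivable_continuous_coords; first exact: normc_lipschitz.
  exact: hd.
pose N := g \_ (square a).
have mN : measurable_fun setT N by exact/(measurable_restrictT _ mQ).
have N0 p : (0 <= N p)%E.
  by apply: erestrict_ge0 => q _; rewrite lee_fin normc_ge0.
rewrite integral_mkcond -/N.
have mn1 : measurable_fun setT (fun p : plane => `|p.1| : measurableTypeR R).
  exact: (measurableT_comp (@normr_measurable R setT)
    (@measurable_fst _ _ (measurableTypeR R) (measurableTypeR R))).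
have mn2 : measurable_fun setT (fun p : plane => `|p.2| : measurableTypeR R).
  exact: (measurableT_comp (@normr_measurable R setT)
    (@measurable_snd _ _ (measurableTypeR R) (measurableTypeR R))).
pose D : set plane := [set p | `|p.1| <= `|p.2|].
have mD : measurable D.
  by rewrite -[X in measurable X]setTI; exact: measurable_fun_le.
pose V := N \_ D; pose W := N \_ (~` D).
have mV : measurable_fun setT V.
  by apply/(measurable_restrictT _ mD); exact: measurable_funTS.
have mW : measurable_fun setT W.
  by apply/(measurable_restrictT _ (measurableC mD)); exact: measurable_funTS.
have V0 p : (0 <= V p)%E by apply: erestrict_ge0 => q _; exact: N0.
have W0 p : (0 <= W p)%E by apply: erestrict_ge0 => q _; exact: N0.
pose SV t := (\int[mu]_x V (x, t))%E; pose SW t := (\int[mu]_y W (t, y))%E.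
have mSV : measurable_fun setT SV by exact: measurable_fun_fubini_tonelli_G.
have mSW : measurable_fun setT SW by exact: measurable_fun_fubini_tonelli_F.
have SV0 t : (0 <= SV t)%E by apply: integral_ge0 => ? _; exact: V0.
have SW0 t : (0 <= SW t)%E by apply: integral_ge0 => ? _; exact: W0.
pose S t := (SV t + SW t)%E.
have mS : measurable_fun setT S by exact: emeasurable_funD.
have S0 t : (0 <= S t)%E by rewrite adde_ge0.
have <- : (\int[mu]_t S t = \int[area]_p N p)%E.
  rewrite ge0_integralD// -[X in (X + _)%E]fubini_tonelli2// -[X in (_ + X)%E]fubini_tonelli1//.
  rewrite -ge0_integralD//; apply: eq_integral => p _.
  rewrite /V /W !patchE in_setC; case: ifPn => _ /=; by rewrite ?adde0 ?add0e.
have edge t : 0 < t -> t < a -> ((2 * pi * t * normc (h 0))%:E <= S t + S (- t)%R)%E.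
  move=> t0 ta.
  have inQ x y : -t <= x <= t -> -t <= y <= t -> square a (x, y).
    by move=> /andP[? ?] /andP[? ?]; split => /=; apply/ltr_normlP; split; lra.
  have tt : `|t| = t by rewrite gtr0_norm.
  have ntt : - t <= - t <= t by apply/andP; split; lra.
  have ttt : - t <= t <= t by apply/andP; split; lra.
  have nE x : (`|x| <= t) = (- t <= x <= t) by rewrite ler_norml.
  have eV s : `|s| = t -> (SV s = \int[mu]_(x in `[(- t)%R, t]) (normc (h (x +i* s)%C))%:E)%E.
    move=> st; rewrite /SV [RHS]integral_mkcond; apply: eq_integral => x _.
    rewrite /V patchE [RHS]patchE.
    have -> : ((x, s) \in D) = (x \in `[- t, t]%classic).
      by apply/idP/idP => /set_mem xD; apply/mem_set; move: xD;
        rewrite /D/= st in_itv/= nE.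
    case: ifPn => // /set_mem/=; rewrite in_itv/= => xt.
    rewrite /N patchE mem_set//; apply: inQ => //.
    by rewrite -nE st.
  have eW s : `|s| = t -> (SW s = \int[mu]_(y in `[(- t)%R, t]) (normc (h (s +i* y)%C))%:E)%E.
    move=> st; rewrite /SW.
    have mline : measurable_fun (`[(- t)%R, t] : set R) (fun y => (normc (h (s +i* y)%C))%:E).
      have mNs : measurable_fun [set: R] (fun y => N (s, y)).
        exact: measurableT_comp mN (pair1_measurable _).
      apply: eq_measurable_fun (measurable_funTS mNs) => y; rewrite mem_setE in_itv/= => yt.
      by rewrite /N patchE mem_set//; apply: inQ => //; rewrite -nE st.
    rewrite -integral_itv_obnd_cbnd; last first.
      by apply: measurable_funS mline => //; apply: subset_itvr; rewrite bnd_simp.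
    rewrite -integral_itv_bndo_bndc//; last first.
      by apply: measurable_funS mline => //; apply: subset_itv; rewrite bnd_simp.
    rewrite [RHS]integral_mkcond; apply: eq_integral => y _.
    rewrite /W patchE [RHS]patchE.
    have -> : ((s, y) \in ~` D) = (y \in `]- t, t[%classic).
      by apply/idP/idP => /set_mem yD; apply/mem_set; move: yD;
        rewrite /D/= st in_itv/= -ltr_norml ltNge => /negP.
    case: ifPn => // /set_mem/=; rewrite in_itv/= => /andP[? ?].
    rewrite /N patchE mem_set//; apply: inQ; first by rewrite -nE st.
    by apply/andP; split; lra.
  rewrite /S !eV ?normrN// !eW ?normrN//.
  rewrite addeACA [X in (X + _)%E]addeC; apply: cauchy_square_ereal => //.
  by move=> x y /(inQ x y) H /H[]; exact: hd.
pose S1 := S \_ `]0, +oo[; pose S2 := S \_ `]-oo, 0[.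
have mS1 : measurable_fun setT S1.
  by apply/(measurable_restrictT _ (measurable_itv _)); exact: measurable_funTS.
have mS2 : measurable_fun setT S2.
  by apply/(measurable_restrictT _ (measurable_itv _)); exact: measurable_funTS.
have S10 t : (0 <= S1 t)%E by apply: erestrict_ge0 => q _; exact: S0.
have S20 t : (0 <= S2 t)%E by apply: erestrict_ge0 => q _; exact: S0.
pose k := 2 * pi * normc (h 0).
have k0 : 0 <= k by rewrite !mulr_ge0 ?normc_ge0// pi_ge0.
apply: (@le_trans _ _ (\int[mu]_(t in `]0%R, a[) (k * t)%:E)%E).
  have cl : {within `[0, a], continuous (fun t : R => k * t)}.
    by apply: continuous_in_subspaceT => t _; exact: mulrl_continuous.
  pose F t := k / 2 * t ^+ 2.
  have dF t : is_derive t (1 : R) F (k * t).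
    have -> : F = (k / 2) *: (@GRing.exp R ^~ 2%N) by [].
    by apply: is_derive_eq; rewrite /GRing.scale/=; field.
  have cF t : {for t, continuous F}.
    apply: (@differentiable_continuous _ R^o R^o); apply/derivable1_diffP.
    exact: ex_derive.
  have ml : measurable_fun (`[0, a] : set R) (fun t : R => k * t).
    exact: subspace_continuous_measurable_fun.
  rewrite integral_itv_bndo_bndc; last first.
    apply/measurable_EFinP; apply: measurable_funS ml => //.
    by apply: subset_itv; rewrite bnd_simp.
  rewrite integral_itv_obnd_cbnd; last first.
    apply/measurable_EFinP; apply: measurable_funS ml => //.
    by apply: subset_itvr; rewrite bnd_simp.
  rewrite (@continuous_FTC2 _ _ F _ _ a0 cl).
  - by rewrite -EFinB lee_fin /F /k le_eqVlt; apply/orP; left; apply/eqP; field.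
  - split=> [t _||]; first exact: ex_derive.
      by apply: cvg_at_right_filter; exact: cF.
    by apply: cvg_at_left_filter; exact: cF.
  - by move=> t _; rewrite derive1E derive_val.
have mS2N : measurable_fun setT (fun t => S2 (- t)%R).
  exact: measurableT_comp mS2 (@oppr_measurable R setT).
have mkt : measurable_fun setT (fun t : R => (k * t)%:E).
  by apply/measurable_EFinP; apply: measurable_funM => //; exact: measurable_cst.
apply: (@le_trans _ _ (\int[mu]_t (S1 t + S2 (- t)%R))%E).
  rewrite integral_mkcond.
  pose L := (fun t : R => (k * t)%:E) \_ `]0, a[.
  have m1 : measurable_fun setT L.
    by apply/(measurable_restrictT _ (measurable_itv _)); exact: measurable_funTS.
  have p1 t : (0 <= L t)%E.
    apply: erestrict_ge0 => u /=; rewrite in_itv/= => /andP[/ltW u0 _].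
    by rewrite lee_fin mulr_ge0.
  have m2 : measurable_fun setT (fun t => S1 t + S2 (- t)%R)%E.
    exact: emeasurable_funD.
  have p2 t : (0 <= S1 t + S2 (- t)%R)%E by rewrite adde_ge0.
  apply: ge0_le_integral => //.
  move=> t _; rewrite patchE mem_setE in_itv/=; case: ifPn => [/andP[t0 ta]|_]; last by rewrite adde_ge0.
  rewrite /S1 /S2 !patchE !mem_setE !in_itv/= t0 oppr_lt0 t0/= /k mulrAC.
  exact: edge.
rewrite ge0_integralD//.
rewrite -(@ge0_integral_reflect R S2)// -ge0_integralD//.
have m12 : measurable_fun setT (fun t => S1 t + S2 t)%E by exact: emeasurable_funD.
have p12 t : (0 <= S1 t + S2 t)%E by rewrite adde_ge0.
apply: ge0_le_integral => //.
move=> t _; rewrite /S1 /S2 !patchE !mem_setE !in_itv/= andbT.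
by case: ltgtP => _; rewrite ?adde0 ?add0e.
Qed.
End AreaMeanValue.

(** * Hyperbolic area *)
Section LogarithmicCoordinates.
Context {R : realType}.
Local Notation mu := (@lebesgue_measure R).
Local Notation plane := (measurableTypeR R * measurableTypeR R)%type.
Local Notation area := (@lebesgue_measure R \x @lebesgue_measure R)%E.

Let S : set (R * R) := [set p | 0 < p.1] `&` ([set p | 0 < p.2] `&` [set p | p.1 * p.2 < 1]).

Let open_S : open S.
Proof.
have o1 : open ((fst : R * R -> R) @^-1` [set x | 0 < x]).
  by apply: open_comp; [move=> p _; exact: cvg_fst|exact: open_gt].
have o2 : open ((snd : R * R -> R) @^-1` [set x | 0 < x]).
  by apply: open_comp; [move=> p _; exact: cvg_snd|exact: open_gt].
have o3 : open ((fun p : R * R => p.1 * p.2) @^-1` [set x | x < 1]).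
  apply: open_comp; last exact: open_lt.
  by move=> p _; apply: (@cvgM R^o); [exact: cvg_fst|exact: cvg_snd].
exact: openI o1 (openI o2 o3).
Qed.

Let mS : measurable (S : set plane).
Proof. exact: open_measurable_plane. Qed.

Let integral_S (G : R -> \bar R) : measurable_fun [set: R] G ->
  (forall s, 0 <= G s)%E ->
  (\int[area]_(p in S) G (ln p.1) =
   \int[mu]_(y in `]0%R, +oo[) ((y^-1)%:E * G (ln y)))%E.
Proof.
move=> mG G0; pose H (p : plane) : \bar R := G (ln p.1).
have mH : measurable_fun setT H.
  exact: (measurableT_comp (measurableT_comp mG (@measurable_ln R)) measurable_fst).
rewrite integral_mkcond fubini_tonelli1; last 2 first.
- by apply/(measurable_restrictT _ mS); exact: measurable_funTS.
- by move=> p; apply: erestrict_ge0 => q _; exact: G0.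
rewrite [RHS]integral_mkcond; apply: eq_integral => y _.
rewrite /fubini_F/= [RHS]patchE mem_setE in_itv/= andbT.
have [y0|y0] := ltP 0 y; last first.
  under eq_integral => v _.
    rewrite patchE memNset; last by case; rewrite /= ltNge y0.
    over.
  by rewrite integral0.
rewrite (_ : (fun v => _) = (cst (G (ln y))) \_ `]0, y^-1[); last first.
  apply/funext => v; rewrite !patchE; congr (if _ then _ else _).
  rewrite mem_setE in_itv/=; apply/idP/idP.
    move=> /set_mem[/= _ [v0 yv]]; rewrite v0/=.
    by rewrite -(ltr_pM2l y0) divff ?gt_eqF.
  move=> /andP[v0 vy]; apply: mem_set; split=> //=; split=> //=.
  by rewrite -(ltr_pM2l y0) divff ?gt_eqF in vy.
rewrite -integral_mkcond integral_cst// muleC.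
by rewrite /= (lebesgue_measure_itv `]0, y^-1[)/= lte_fin invr_gt0 y0 oppr0 adde0.
Qed.

(** The region [S] under the graph of [1 / y] has [dy / y] as the image of its area
by the first projection; by the fundamental theorem of calculus, the image of
this measure by [ln] agrees with Lebesgue measure on intervals. *)
Lemma ge0_integral_log (G : R -> \bar R) : measurable_fun [set: R] G ->
  (forall s, 0 <= G s)%E ->
  (\int[mu]_s G s = \int[mu]_(y in `]0%R, +oo[) ((y^-1)%:E * G (ln y)))%E.
Proof.
move=> mG G0; rewrite -integral_S//.
pose phi (p : plane) : measurableTypeR R := ln p.1.
have mphi : measurable_fun setT phi.
  exact: (measurableT_comp (@measurable_ln R) measurable_fst).
pose m0 : {measure set (measurableTypeR R) -> \bar R} :=
  pushforward (mrestr area mS) phi.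
pose m := m0 mphi.
have E A : measurable A -> mu A = m A.
  apply: lebesgue_measure_unique => _ [[a b]] _ <-.
  rewrite /= (lebesgue_measure_itv `]a, b])/= lte_fin /m/= /pushforward /mrestr.
  set B := [set` `]a, b]].
  have -> : area (phi @^-1` B `&` S) = (\int[area]_(p in S) (\1_B (ln p.1))%:E)%E.
    have mB : measurable (phi @^-1` B).
      by rewrite -[X in measurable X]setTI; exact: (mphi measurableT B (measurable_itv _)).
    transitivity (\int[area]_(p in S) (\1_(phi @^-1` B) p)%:E)%E.
      by rewrite integral_indic.
    by apply: eq_integral => p _; rewrite !indicE.
  rewrite (integral_S (G := fun x => (\1_B x)%:E))//; last first.
    by apply/measurable_EFinP; apply: measurable_indic; exact: measurable_itv.
  have [ab|ba] := ltP a b; last first.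
    rewrite integral0_eq// => y _.
    by rewrite /B set_itv_ge ?bnd_simp -?leNgt// indic0 mule0.
  transitivity (\int[mu]_(y in `]expR a, expR b]) (y^-1)%:E)%E; last first.
    rewrite [LHS]integral_mkcond [RHS]integral_mkcond.
    apply: eq_integral => y _; rewrite !patchE !mem_setE !in_itv/= andbT.
    have [y0|y0] := ltP 0 y; last first.
      by rewrite ltNge (le_trans y0) ?expR_ge0.
    have yE : expR (ln y) = y by rewrite lnK.
    rewrite indicE mem_setE in_itv/= -(ltr_expR a) -(ler_expR _ b) yE.
    by case: ifPn => _; rewrite ?mule1 ?mule0.
  have eab : expR a < expR b by rewrite ltr_expR.
  have cV : {within `[expR a, expR b], continuous (fun y : R => y^-1)}.
    apply: continuous_in_subspaceT => y; rewrite inE/= in_itv/= => /andP[ay _].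
    by apply: inv_continuous; rewrite gt_eqF// (lt_le_trans _ ay)// expR_gt0.
  have mV : measurable_fun `[expR a, expR b] (fun y : R => y^-1).
    exact: subspace_continuous_measurable_fun.
  rewrite integral_itv_obnd_cbnd; last first.
    apply/measurable_EFinP; apply: measurable_funS mV => //.
    by apply: subset_itvr; rewrite bnd_simp.
  have dln y : expR a <= y -> is_derive y (1 : R) (@ln R) y^-1.
    by move=> ay; apply: is_derive1_ln; rewrite (lt_le_trans _ ay)// expR_gt0.
  have cln y : expR a <= y -> {for y, continuous (@ln R)}.
    move=> ay; apply: continuous_ln; by rewrite (lt_le_trans _ ay)// expR_gt0.
  rewrite (@continuous_FTC2 _ _ (@ln R) _ _ eab cV) ?expRK ?EFinB//.
    split=> [y||].
    - by rewrite in_itv/= => /andP[/ltW ay _]; have := dln y ay => ?; exact: ex_derive.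
    - by apply: cvg_at_right_filter; apply: cln.
    - by apply: cvg_at_left_filter; apply: cln; exact: ltW.
  move=> y; rewrite in_itv/= => /andP[/ltW ay _]; have := dln y ay => ?.
  by rewrite derive1E derive_val.
transitivity (\int[m]_s G s)%E.
  by apply: eq_measure_integral => A mA _; exact: E.
have P := @ge0_integral_pushforward _ _ _ _ R phi mphi (mrestr area mS) setT G
  measurableT mG (fun s _ => G0 s).
rewrite preimage_setT in P; rewrite [LHS]P.
have mGphi : measurable_fun setT (G \o phi) by exact: measurableT_comp mG mphi.
have Gphi0 p : (0 <= (G \o phi) p)%E by exact: G0.
have Q := @ge0_integral_mrestr R _ _ area _ mS _ mGphi Gphi0.
rewrite [LHS]Q.
exact: erefl.
Qed.
End LogarithmicCoordinates.

Section HyperbolicArea.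
Context {R : realType}.
Local Notation plane := (measurableTypeR R * measurableTypeR R)%type.
Local Notation area := (@lebesgue_measure R \x @lebesgue_measure R)%E.

(** Coordinates [(u, s)] of the half-plane with [x = u * e^s] and [y = e^s]. The
hyperbolic area [dx dy / y^2] becomes [du ds], so that its invariance under
Moebius transformations is preservation of the Euclidean area. *)
Definition horo (q : R * R) : R * R := (expR q.2 * q.1, expR q.2).

Lemma measurable_horo : measurable_fun setT (horo : plane -> plane).
Proof.
have me := measurableT_comp (@measurable_expR R)
  (@measurable_snd _ _ (measurableTypeR R) (measurableTypeR R)).
apply: measurable_fun_pair; last exact: me.
exact: (measurable_funM me measurable_fst).
Qed.

(** Tonelli's theorem, with the substitution [x = y * u] in each horizontal line
and [y = e^s] afterwards. *)
Lemma ge0_integral_horo (f : plane -> \bar R) : measurable_fun setT f ->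
  (forall p, 0 <= f p)%E ->
  (\int[area]_(p in [set p | (0 < p.2)%R]) f p =
   \int[area]_q ((expR q.2 ^+ 2)%:E * f (horo q)))%E.
Proof.
move=> mf f0; pose K (q : plane) : \bar R := ((expR q.2 ^+ 2)%:E * f (horo q))%E.
have me := measurableT_comp (@measurable_expR R)
  (@measurable_snd _ _ (measurableTypeR R) (measurableTypeR R)).
have mK : measurable_fun setT K.
  apply: emeasurable_funM; last exact: measurableT_comp mf measurable_horo.
  by apply/measurable_EFinP; exact: measurable_funX.
have K0 q : (0 <= K q)%E by rewrite mule_ge0// lee_fin exprn_ge0// expR_ge0.
have mH : measurable ([set p | 0 < p.2] : set plane) by exact: measurable_upper.
rewrite [RHS]fubini_tonelli2// ge0_integral_log; last 2 first.
- exact: measurable_fun_fubini_tonelli_G.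
- by move=> s; apply: integral_ge0 => u _; exact: K0.
rewrite integral_mkcond fubini_tonelli2; last 2 first.
- by apply/(measurable_restrictT _ mH); exact: measurable_funTS.
- by move=> p; apply: erestrict_ge0 => q _; exact: f0.
rewrite [RHS]integral_mkcond; apply: eq_integral => y _.
rewrite /fubini_G [RHS]patchE mem_setE in_itv/= andbT.
have [y0|y0] := ltP 0 y; last first.
  under eq_integral => x _.
    rewrite patchE memNset; last by rewrite /= ltNge y0.
    over.
  by rewrite integral0.
under eq_integral => x _.
  rewrite patchE mem_set; last by [].
  over.
have yE : expR (ln y) = y by rewrite lnK.
have mfy : measurable_fun [set: R] (fun x => f (x, y)).
  exact: measurableT_comp mf (pair2_measurable _).
have mM : measurable_fun [set: R] ( *%R y).
  by apply: measurable_funM => //; exact: measurable_cst.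
rewrite /K /horo/= yE ge0_integralZl//; last 2 first.
- exact: (measurableT_comp mfy mM).
- by rewrite lee_fin exprn_ge0// ltW.
rewrite muleA -EFinM expr2 mulKf ?gt_eqF//.
rewrite (@ge0_integral_affine _ y 0)//; congr (_ * _)%E.
by apply: eq_integral => x _; rewrite addr0.
Qed.

Local Notation point q := (Complex (horo q).1 (horo q).2).

Lemma Im_point_gt0 q : 0 < (horo q).2.
Proof. exact: expR_gt0. Qed.

Definition moebius_lifts (A : 'M[R]_2) := exists2 m : R * R -> R * R,
  area_preserving m & forall q, point (m q) = moebius A (point q).

Lemma moebius_lifts_mul A B : \det A = 1 -> \det B = 1 ->
  moebius_lifts A -> moebius_lifts B -> moebius_lifts (A * B).
Proof.
move=> dA dB [m1 a1 e1] [m2 a2 e2]; exists (m1 \o m2).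
  exact: area_preserving_comp.
by move=> q; rewrite /= e1 e2 moebiusM//; exact: Im_point_gt0.
Qed.

Definition mat2 (a b c d : R) : 'M[R]_2 :=
  \matrix_(i, j) (if i == 0 then if j == 0 then a else b
                  else if j == 0 then c else d).

Lemma unit_det1 (A : 'M[R]_2) : \det A = 1 -> A \is a GRing.unit.
Proof. by move=> dA; change (A \in unitmx); rewrite unitmxE dA unitr1. Qed.

Lemma moebius_mat2 a b c d z : moebius (mat2 a b c d) z =
  ((a%:C * z + b%:C) / (c%:C * z + d%:C))%C.
Proof. by rewrite /moebius /denom !mxE. Qed.

Lemma det_mat2 a b c d : \det (mat2 a b c d) = a * d - b * c.
Proof.
rewrite (expand_det_row _ 0) !big_ord_recl big_ord0 /cofactor !det_mx11 !mxE/=.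
by rewrite addr0 expr0 expr1; ring.
Qed.

Lemma mat2E (A : 'M[R]_2) : A = mat2 (A 0 0) (A 0 1) (A 1 0) (A 1 1).
Proof.
by apply/matrixP => i j; rewrite mxE; case: i j => [[|[|//]] i] [[|[|//]] j] /=;
  congr (A _ _); apply/val_inj.
Qed.

Lemma mat2M a b c d a' b' c' d' : mat2 a b c d * mat2 a' b' c' d' =
  mat2 (a * a' + b * c') (a * b' + b * d') (c * a' + d * c') (c * b' + d * d').
Proof.
apply/matrixP => i j; rewrite !mxE !big_ord_recl big_ord0 !mxE/= addr0.
by case: ifP => _; case: ifP.
Qed.

Lemma moebius_lifts_translation b : moebius_lifts (mat2 1 b 0 1).
Proof.
exists (fun q => (q.1 + b * expR (- q.2), q.2)).
  apply: (@area_preserving_shear1 R (fun s => b * expR (- s))).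
  apply: measurable_funM => //; apply: (measurableT_comp (@measurable_expR R)).
  exact: measurable_funN.
move=> q; rewrite moebius_mat2 mul1r mul0r add0r divr1 /horo/=.
apply/eqP; rewrite eq_complex/= addr0 eqxx andbT mulrDr mulrCA.
by rewrite expRxMexpNx_1 mulr1.
Qed.

Lemma moebius_lifts_dilation a : a != 0 -> moebius_lifts (mat2 a 0 0 a^-1).
Proof.
move=> a0; have a20 : 0 < a ^+ 2 by rewrite exprn_even_gt0//= a0.
exists (fun q => (q.1, q.2 + ln (a ^+ 2))).
  exact: (@area_preserving_shear2 R (fun=> ln (a ^+ 2))).
move=> q; rewrite moebius_mat2 mul0r add0r addr0 /horo/=.
have -> : ((a^-1)%:C = a%:C^-1)%C by rewrite fmorphV.
rewrite invrK expRD lnK//.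
by apply/eqP; rewrite eq_complex/=; apply/andP; split; apply/eqP; ring.
Qed.

(** In these coordinates [z |-> - 1 / z] sends [(u, s)] to
[(- u, - s - ln (1 + u^2))], a shear after a point reflection. *)
Lemma moebius_lifts_inversion : moebius_lifts (mat2 0 (-1) 1 0).
Proof.
exists ((fun p => (p.1, p.2 + - ln (1 + p.1 ^+ 2))) \o (fun p => (- p.1, - p.2))).
  apply: area_preserving_comp; last exact: area_preserving_opp.
  apply: (@area_preserving_shear2 R (fun x => - ln (1 + x ^+ 2))).
  apply: measurable_funN; apply: (measurableT_comp (@measurable_ln R)).
  by apply: measurable_funD => //; exact: measurable_funX.
move=> [u s]; rewrite moebius_mat2 mul0r add0r addr0 mul1r /horo/=.
have u1 : 0 < 1 + u ^+ 2 by rewrite ltr_wpDr ?sqr_ge0.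
have s0 : expR s != 0 by rewrite gt_eqF// expR_gt0.
rewrite sqrrN expRD !expRN lnK//.
by apply/eqP; rewrite eq_complex/=; apply/andP; split; apply/eqP; field;
  rewrite ?s0 ?gt_eqF//; rewrite (_ : (expR s * u) ^+ 2 + expR s ^+ 2 = expR s ^+ 2 * (1 + u ^+ 2)) ?mulr_gt0 ?exprn_gt0 ?expR_gt0//; ring.
Qed.

(** Translations, dilations and [z |-> - 1 / z] generate the group (Bruhat
decomposition), and all three act by shears and reflections. *)
Lemma moebius_liftsP (A : 'M[R]_2) : \det A = 1 -> moebius_lifts A.
Proof.
rewrite (mat2E A); set a := A 0 0; set b := A 0 1; set c := A 1 0; set d := A 1 1.
rewrite det_mat2 => dA.
have lM B C : \det B = 1 -> \det C = 1 -> moebius_lifts B -> moebius_lifts C ->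
    \det (B * C) = 1 /\ moebius_lifts (B * C).
  move=> dB dC lB lC; split; last exact: moebius_lifts_mul.
  by rewrite -[B * C]/(B *m C) det_mulmx dB dC mulr1.
have dT t : \det (mat2 1 t 0 1) = 1 by rewrite det_mat2; ring.
have dD t : t != 0 -> \det (mat2 t 0 0 t^-1) = 1.
  by move=> t0; rewrite det_mat2; field.
have dS : \det (mat2 0 (-1) 1 0) = 1 by rewrite det_mat2; ring.
have [c0|c0] := eqVneq c 0.
  have ad : a * d = 1 by rewrite -dA c0 mulr0 subr0.
  have a0 : a != 0 by apply: contra_eq_neq ad => ->; rewrite mul0r eq_sym oner_eq0.
  have -> : mat2 a b c d = mat2 1 (a * b) 0 1 * mat2 a 0 0 a^-1.
    rewrite mat2M c0; congr mat2; try ring; first by field.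
    by rewrite -(mulKf a0 d) ad; ring.
  by apply lM; rewrite ?dT ?dD//; [exact: moebius_lifts_translation|
    exact: moebius_lifts_dilation].
have -> : mat2 a b c d = mat2 1 (a / c) 0 1 *
    (mat2 0 (-1) 1 0 * (mat2 c 0 0 c^-1 * mat2 1 (d / c) 0 1)).
  rewrite !mat2M; congr mat2; [by field| |by field|by field].
  have -> : b = (a * d - 1) / c by rewrite -dA; field.
  by field.
have [d1 l1] := lM _ _ (dD c c0) (dT (d / c))
  (moebius_lifts_dilation c0) (moebius_lifts_translation _).
have [d2 l2] := lM _ _ dS d1 moebius_lifts_inversion l1.
by have [] := lM _ _ (dT (a / c)) d2 (moebius_lifts_translation _) l2.
Qed.

End HyperbolicArea.

(** * Unfolding over a fundamental domain *)
Section Unfolding.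
Context {R : realType}.
Local Notation normc := (@Normc.normc R).
Local Notation Im := (@complex.Im R).
Local Notation plane := (measurableTypeR R * measurableTypeR R)%type.
Local Notation area := (@lebesgue_measure R \x @lebesgue_measure R)%E.
Local Notation point q := (Complex (horo q).1 (horo q).2).
Implicit Types (G : psl2_subgroup R) (F : R[i] -> R[i]).

Lemma horo_inj : injective (@horo R).
Proof.
move=> [u s] [u' s'] [e1 e2]; have ss : s = s' by apply: expR_inj.
move: e1; rewrite /= ss => /mulfI ->//.
by rewrite gt_eqF// expR_gt0.
Qed.

Lemma det2E (A : 'M[R]_2) : \det A = A 0 0 * A 1 1 - A 0 1 * A 1 0.
Proof. by rewrite [in LHS](mat2E A) det_mat2. Qed.

(** The denominator is kept on the left: [|denom A z| ^-2] is the scaling factor of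
the Moebius transformation at [z]. *)
Lemma Im_moebius (A : 'M[R]_2) z : \det A = 1 -> upper_half_plane z ->
  Im (moebius A z) * normc (denom A z) ^+ 2 = Im z.
Proof.
move=> dA z0; have := denom_neq0 dA z0; move: dA; rewrite det2E /moebius /denom sqr_normcE.
move: (A 0 0) (A 0 1) (A 1 0) (A 1 1) => a b c d dA.
case: z z0 => x y /= z0; rewrite eq_complex/= negb_and !(mul0r, subr0, addr0, add0r).
set p := c * x + d; set q := c * y => pq.
have pq0 : p ^+ 2 + q ^+ 2 != 0.
  by rewrite paddr_eq0 ?sqr_ge0// !sqrf_eq0 negb_and.
have -> : (a * x + b) * (- (q / (p ^+ 2 + q ^+ 2))) + a * y * (p / (p ^+ 2 + q ^+ 2)) =
    (a * d - b * c) * y / (p ^+ 2 + q ^+ 2).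
  by rewrite /p /q; field; rewrite -/p -/q.
by rewrite dA mul1r divfK.
Qed.

Lemma upper_moebius (A : 'M[R]_2) (z : R[i]) : \det A = 1 ->
  upper_half_plane z -> upper_half_plane (moebius A z).
Proof.
move=> dA z0; have E := Im_moebius dA z0; have d0 := denom_neq0 dA z0.
by move: z0; rewrite /upper_half_plane/= -E pmulr_lgt0// exprn_gt0// normc_gt0.
Qed.

Lemma moebiusVK G A (z : R[i]) : psl2_set G A -> upper_half_plane z ->
  moebius A^-1 (moebius A z) = z.
Proof.
move=> GA z0; have dA := psl2_det GA; have dV := psl2_det (psl2_inv GA).
by rewrite -moebiusM// mulVr ?moebius1//; exact: unit_det1.
Qed.

Lemma moebiusKV G A (z : R[i]) : psl2_set G A -> upper_half_plane z ->
  moebius A (moebius A^-1 z) = z.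
Proof.
move=> GA z0; have dA := psl2_det GA; have dV := psl2_det (psl2_inv GA).
by rewrite -moebiusM// mulrV ?moebius1//; exact: unit_det1.
Qed.

(** The invariant function [y^2 |F|^2], read in the coordinates [horo]: it is the
density of [|F|^2 dx dy] with respect to the hyperbolic area. *)
Definition density F (q : plane) : \bar R :=
  ((expR q.2 * normc (F (point q))) ^+ 2)%:E.

Lemma density_ge0 F q : (0 <= density F q)%E.
Proof. by rewrite lee_fin sqr_ge0. Qed.

Lemma cusp_form_coordinate G F (L : R[i] -> R) : cusp_form2 G F ->
  (forall u v, `|L u - L v| <= normc (u - v)) ->
  measurable_fun ([set p | 0 < p.2] : set plane)
    (fun p => L (F (p.1 +i* p.2)%C) : measurableTypeR R).
Proof.
move=> [dF _] Llip; apply: continuous_measurable_plane; first exact: open_upper.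
by move=> p p0; apply: (@derivable_continuous_coords R F L p Llip); exact: dF.
Qed.

Lemma cusp_form_measurable G F : cusp_form2 G F ->
  measurable_fun ([set p | 0 < p.2] : set plane)
    (fun p => (normc (F (p.1 +i* p.2)%C) ^+ 2)%:E).
Proof.
move=> cF; apply/measurable_EFinP; apply: measurable_funX.
exact: cusp_form_coordinate cF (@normc_lipschitz R).
Qed.

Lemma density_measurable G F : cusp_form2 G F -> measurable_fun setT (density F).
Proof.
move=> cF; have := (measurable_restrictT _ measurable_upper).1 (cusp_form_measurable cF).
set f := _ \_ _ => mf.
have -> : density F = (fun q => ((expR q.2) ^+ 2)%:E * f (horo q))%E.
  apply/funext => q; rewrite /density /f patchE mem_set; last exact: Im_point_gt0.
  by rewrite exprMn EFinM.
have me := measurableT_comp (@measurable_expR R)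
  (@measurable_snd _ _ (measurableTypeR R) (measurableTypeR R)).
have m1 : measurable_fun setT (fun q : plane => (expR q.2 ^+ 2)%:E).
  by apply/measurable_EFinP; exact: (measurable_funX _ me).
have m2 : measurable_fun setT (f \o @horo R : plane -> \bar R).
  exact: measurableT_comp mf measurable_horo.
exact: (emeasurable_funM m1 m2).
Qed.

Lemma measurable_horo_preimage (E : set R[i]) : measurable (coords E) ->
  measurable ([set q | E (point q)] : set plane).
Proof.
by move=> mE; have := measurable_horo (R := R) measurableT mE; rewrite setTI.
Qed.

Lemma integral_density G F (E : set R[i]) : cusp_form2 G F ->
  measurable (coords E) -> E `<=` upper_half_plane ->
  (\int[area]_(p in coords E) (normc (F (p.1 +i* p.2)%C) ^+ 2)%:E =
   \int[area]_(q in [set q | E (point q)]) density F q)%E.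
Proof.
move=> cF mE EH.
pose g (p : plane) : \bar R := (normc (F (p.1 +i* p.2)%C) ^+ 2)%:E.
have mg : measurable_fun (coords E) g.
  apply: measurable_funS (cusp_form_measurable cF) => //.
    exact: measurable_upper.
  by move=> p /EH.
have mgE : measurable_fun setT (g \_ (coords E)) by exact/(measurable_restrictT _ mE).
have gE0 p : (0 <= (g \_ (coords E)) p)%E.
  by apply: erestrict_ge0 => q _; rewrite lee_fin sqr_ge0.
transitivity (\int[area]_(p in [set p | (0 < p.2)%R]) (g \_ (coords E)) p)%E.
  rewrite integral_mkcond [RHS]integral_mkcond; apply: eq_integral => p _.
  rewrite [RHS]patchE; case: ifPn => // /negP p0.
  rewrite patchE memNset// => /EH Ep; apply: p0; exact: mem_set.
rewrite ge0_integral_horo// [RHS]integral_mkcond; apply: eq_integral => q _.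
rewrite !patchE; have -> : (horo q \in coords E) = (q \in [set q | E (point q)]).
  by apply/idP/idP => /set_mem ?; exact: mem_set.
by case: ifPn => _; rewrite ?mule0// /density /g exprMn EFinM.
Qed.

Lemma density_invariant G F A (m : R * R -> R * R) : cusp_form2 G F ->
  psl2_set G A -> (forall q, point (m q) = moebius A (point q)) ->
  forall q, density F (m q) = density F q.
Proof.
move=> [_ tF] GA mE q; rewrite /density mE tF//; last exact: Im_point_gt0.
have E : expR (m q).2 * normc (denom A (point q)) ^+ 2 = expR q.2.
  have := Im_moebius (psl2_det GA) (Im_point_gt0 q : upper_half_plane (point q)).
  by rewrite -mE.
have nX (z : R[i]) : normc (z ^+ 2) = normc z ^+ 2 by rewrite !expr2 Normc.normcM.
by rewrite Normc.normcM nX mulrA E.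
Qed.

(** Enumerate [G], and cut [Q] into the pieces [E n] of the points which the [n]-th
element is the first to send into [D]. The images [C n] of the pieces lie in
[D]; they are disjoint because distinct points of [Q] are never in the same
orbit; and each has the same integral as its piece, by invariance. *)
Lemma unfolding G F (D Q : set R[i]) : countable (psl2_set G) ->
  cusp_form2 G F -> measurable (coords D) -> D `<=` upper_half_plane ->
  (forall z, upper_half_plane z -> exists2 A, psl2_set G A & D (moebius A z)) ->
  measurable (coords Q) -> Q `<=` upper_half_plane ->
  (forall A w, psl2_set G A -> Q w -> Q (moebius A w) -> moebius A w = w) ->
  (\int[area]_(p in coords Q) (normc (F (p.1 +i* p.2)%C) ^+ 2)%:E <=
   \int[area]_(p in coords D) (normc (F (p.1 +i* p.2)%C) ^+ 2)%:E)%E.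
Proof.
move=> /countable_injP[c cinj] cF mD DH Dcover mQ QH Qinj.
rewrite !(integral_density cF)//.
pose e n : 'M[R]_2 := xget 1 [set A | psl2_set G A /\ c A = n].
have eG n : psl2_set G (e n).
  by rewrite /e; case: xgetP => [A _ []//|_]; exact: psl2_1.
have eS A : psl2_set G A -> exists n, e n = A.
  move=> GA; exists (c A); rewrite /e; case: xgetP => [B _ [GB cB]|/(_ A)[]//].
  by apply: cinj => //; exact: mem_set.
have uP (q : R * R) : upper_half_plane (point q) by exact: Im_point_gt0.
have lift A : psl2_set G A -> exists m : R * R -> R * R,
    area_preserving m /\ forall q, point (m q) = moebius A (point q).
  by move=> GA; have [m ? ?] := moebius_liftsP (psl2_det GA); exists m.
pose D' : set plane := [set q | D (point q)].
pose Q' : set plane := [set q | Q (point q)].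
have mD' : measurable D' by exact: measurable_horo_preimage.
have mQ' : measurable Q' by exact: measurable_horo_preimage.
pose B n : set plane := [set q | D (moebius (e n) (point q))].
have preim (m : R * R -> R * R) (E : set plane) : area_preserving m ->
    measurable E -> measurable (m @^-1` E).
  by move=> [mm _] mE; rewrite -[X in measurable X]setTI; exact: mm.
have mB n : measurable (B n).
  have [m [am mE]] := lift _ (eG n).
  rewrite (_ : B n = m @^-1` D'); first exact: preim.
  by apply/seteqP; split => q /=; rewrite /B /D' /preimage /mkset mE.
pose E n : set plane := Q' `&` seqDU B n.
have mE n : measurable (E n).
  by apply: measurableI => //; exact: seqDU_measurable.
have tE : trivIset setT E.
  by apply: trivIset_setIl; exact: trivIset_seqDU.
have QE : Q' = \bigcup_n E n.
  rewrite -setI_bigcupr -seqDU_bigcup_eq; apply/esym/setIidPl => q _.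
  by have [A GA DA] := Dcover _ (uP q); have [n en] := eS A GA; exists n; rewrite // /B/= en.
have mdF := density_measurable cF.
pose C n : set plane := [set q | exists2 p, E n p & point q = moebius (e n) (point p)].
have mC n : measurable (C n) /\
    (\int[area]_(q in E n) density F q = \int[area]_(q in C n) density F q)%E.
  have [m [am mE']] := lift _ (psl2_inv (eG n)).
  have CE : C n = m @^-1` (E n).
    apply/seteqP; split => q.
      move=> [p Ep qp]; rewrite /preimage/=.
      suff -> : m q = p by [].
      apply: horo_inj; have := mE' q; rewrite qp (moebiusVK (eG n) (uP p)).
      by case: (horo (m q)) (horo p) => ? ? [? ?] /= [-> ->].
    move=> Emq; exists (m q) => //.
    by rewrite mE' (moebiusKV (eG n) (uP q)).
  split; first by rewrite CE; exact: preim.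
  rewrite integral_mkcond [RHS]integral_mkcond CE -am.2; last 2 first.
  - by apply/(measurable_restrictT _ (mE n)); exact: measurable_funTS.
  - by move=> q; apply: erestrict_ge0 => ? _; exact: density_ge0.
  apply: eq_integral => q _; rewrite !patchE.
  rewrite (density_invariant cF (psl2_inv (eG n)) mE').
  by congr (if _ then _ else _); apply/idP/idP => /set_mem ?; exact: mem_set.
have CD : \bigcup_n C n `<=` D'.
  move=> q [n _ [p [_ Bp] qp]]; rewrite /D'/= qp.
  exact: (subset_seqDU Bp).
have tC : trivIset setT C.
  move=> i j _ _ [q [[p Ep qp] [p' Ep' qp']]].
  have pp' : p = p'.
    apply: horo_inj.
    have : moebius ((e j)^-1 * e i) (point p) = point p.
      apply: Qinj; [exact: psl2_mul (psl2_inv (eG j)) (eG i)|exact: Ep.1|].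
      rewrite moebiusM; last exact: uP; last exact: psl2_det (eG i); last exact: psl2_det (psl2_inv (eG j)).
      by rewrite -qp qp' (moebiusVK (eG j) (uP p')); exact: Ep'.1.
    rewrite moebiusM; last exact: uP; last exact: psl2_det (eG i); last exact: psl2_det (psl2_inv (eG j)).
    rewrite -qp qp' (moebiusVK (eG j) (uP p')).
    by case: (horo p) (horo p') => ? ? [? ?] /= [-> ->].
  by apply: (tE i j I I); exists p; split => //; rewrite pp'.
rewrite -/Q' QE ge0_integral_bigcup//; last 2 first.
- exact: measurable_funTS.
- by move=> q _; exact: density_ge0.
under eq_eseriesr => n _ do rewrite (mC n).2.
rewrite -ge0_integral_bigcup//; last 3 first.
- by move=> n; exact: (mC n).1.
- exact: measurable_funTS.
- by move=> q _; exact: density_ge0.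
apply: ge0_subset_integral => //.
- by apply: bigcup_measurable => n _; exact: (mC n).1.
- exact: measurable_funTS.
- by move=> q _; exact: density_ge0.
Qed.
End Unfolding.

(** * Discrete groups of Moebius transformations *)
Section DiscreteGroups.
Context {R : realType}.
Local Notation normc := (@Normc.normc R).
Local Notation Im := (@complex.Im R).
Implicit Types (G : psl2_subgroup R) (A B : 'M[R]_2).

Lemma ord2_forall (P : 'I_2 -> 'I_2 -> Prop) :
  P 0 0 -> P 0 1 -> P 1 0 -> P 1 1 -> forall i j, P i j.
Proof.
have two (Q : 'I_2 -> Prop) : Q 0 -> Q 1 -> forall i, Q i.
  move=> Q0 Q1 [[|[|k]] ik] //.
  - by have -> : Ordinal ik = 0 by exact/val_inj.
  - by have -> : Ordinal ik = 1 by exact/val_inj.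
by move=> ? ? ? ?; apply: (two); apply: (two).
Qed.

Lemma invmx2E A : \det A = 1 -> A^-1 = mat2 (A 1 1) (- A 0 1) (- A 1 0) (A 0 0).
Proof.
move=> dA; have uA := unit_det1 dA.
apply: (mulrI uA); rewrite mulrV// [X in X * _](mat2E A) mat2M.
rewrite det2E in dA; apply/matrixP; apply: ord2_forall; rewrite !mxE/=; lra.
Qed.

(** Discreteness at the identity is uniform after multiplication by an inverse. *)
Lemma fuchsian_gap G : fuchsian G -> exists2 e : R, 0 < e &
  forall A, psl2_set G A -> (forall i j, `|(A - 1) i j| < e) -> A = 1.
Proof.
move=> /(_ 1 (psl2_1 G))[_ [V /nbhs_ballP[e /= e0 eV] VG]].
exists e => // A GA Ae; suff : [set 1] A by [].
rewrite -VG; split => //; apply: eV; split => // i j.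
by rewrite -ball_normE/= distrC; have := Ae i j; rewrite !mxE.
Qed.

Definition bounded_part G (M : R) : set 'M[R]_2 :=
  [set A | psl2_set G A /\ forall i j, `|A i j| <= M].

Lemma bounded_part_separated G M : fuchsian G -> 0 <= M ->
  exists2 d : R, 0 < d & forall A B, bounded_part G M A -> bounded_part G M B ->
    (forall i j, `|A i j - B i j| < d) -> A = B.
Proof.
move=> /fuchsian_gap[e e0 gap] M0; exists (e / (2 * M + 1)); first by rewrite divr_gt0//; lra.
move=> A B [GA AM] [GB BM] AB.
have dA := psl2_det GA.
have uA := unit_det1 dA.
suff : A^-1 * B = 1 by move=> /(congr1 (fun X => A * X)); rewrite mulVKr// mulr1.
apply: gap; first exact: psl2_mul (psl2_inv GA) GB.
move=> i j; rewrite (_ : A^-1 * B - 1 = A^-1 * (B - A)); last by rewrite mulrBr mulVr.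
have VM : forall i j, `|A^-1 i j| <= M.
  by rewrite invmx2E//; apply: ord2_forall; rewrite mxE/= ?normrN.
rewrite -[A^-1 * _]/(A^-1 *m _) mxE !big_ord_recl big_ord0 addr0.
set k := lift _ _; rewrite !mxE.
apply: le_lt_trans (ler_normD _ _) _; rewrite !normrM.
set d := e / (2 * M + 1) in AB.
have d0 : 0 < d by rewrite divr_gt0//; lra.
have le l : `|A^-1 i l| * `|B l j - A l j| <= M * d.
  by apply: ler_pM => //; rewrite distrC ltW.
apply: le_lt_trans (lerD (le _) (le _)) _.
have -> : e = (2 * M + 1) * d by rewrite mulrC divfK// gt_eqF//; lra.
by lra.
Qed.

(** Rounding the entries to a grid of mesh [d] is injective on a [d]-separated
set, and it takes finitely many values on a bounded one. *)
Lemma finite_bounded_part G M : fuchsian G -> finite_set (bounded_part G M).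
Proof.
move=> fG; have [M0|M0] := ltP M 0.
  rewrite (_ : bounded_part G M = set0) //; apply/seteqP; split => // A [_ /(_ 0 0) A0].
  by have := le_lt_trans (le_trans (normr_ge0 _) A0) M0; rewrite ltxx.
have [d d0 dP] := bounded_part_separated fG M0.
pose K := Num.trunc (2 * M / d).
pose f (A : 'M[R]_2) : 'M['I_K.+1]_2 := \matrix_(i, j) inord (Num.trunc ((A i j + M) / d)).
have finj : {in bounded_part G M &, injective f}.
  move=> A B /set_mem pA /set_mem pB fAB; apply: dP => // i j.
  have pos C : bounded_part G M C -> 0 <= (C i j + M) / d.
    by move=> [_ /(_ i j)/ler_normlP[? ?]]; apply: divr_ge0; [lra|exact: ltW].
  have ltK C : bounded_part G M C -> (Num.trunc ((C i j + M) / d) < K.+1)%N.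
    move=> pC; rewrite ltnS; apply: le_truncn.
    by rewrite ler_pM2r ?invr_gt0//; move: pC => [_ /(_ i j)/ler_normlP[? ?]]; lra.
  have : Num.trunc ((A i j + M) / d) = Num.trunc ((B i j + M) / d).
    move/matrixP: fAB => /(_ i j); rewrite !mxE => /(congr1 (@nat_of_ord _)).
    by rewrite !inordK ?ltK.
  have := truncn_itv (pos A pA); have := truncn_itv (pos B pB).
  move=> /andP[b1 b2] /andP[a1 a2] E; rewrite E in a1 a2.
  move: a1 a2 b1 b2; rewrite -natr1; set n := (_ %:R); rewrite !ler_pdivlMr// !ltr_pdivrMr//.
  by move=> *; apply/ltr_normlP; split; lra.
by rewrite -(eq_finite_set (inj_card_eq finj)); exact: finite_finset.
Qed.

Lemma fuchsian_countable G : fuchsian G -> countable (psl2_set G).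
Proof.
move=> fG; rewrite (_ : psl2_set G = \bigcup_n bounded_part G n%:R).
  by apply: bigcup_countable => // n _; apply: finite_set_countable; exact: finite_bounded_part.
apply/seteqP; split=> [A GA|A [n _ []]//].
exists (Num.bound (\sum_i \sum_j `|A i j|)) => //; split => // i j.
have S0 : 0 <= \sum_i \sum_j `|A i j| by do 2 apply: sumr_ge0 => ? _.
apply: le_trans (ltW (archi_boundP S0)).
rewrite (bigD1 i)//= (bigD1 j)//= -addrA lerDl addr_ge0//; first exact: sumr_ge0.
by apply: sumr_ge0 => ? _; exact: sumr_ge0.
Qed.

(** [cosh d - 1] for the hyperbolic distance [d] of [z] and [w]. *)
Definition displacement (z w : R[i]) : R := normc (z - w) ^+ 2 / (2 * Im z * Im w).

Lemma displacement_moebius A z : \det A = 1 -> upper_half_plane z ->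
  displacement z (moebius A z) =
  normc (z * denom A z - ((A 0 0)%:C * z + (A 0 1)%:C)%C) ^+ 2 / (2 * Im z ^+ 2).
Proof.
move=> dA z0; have d0 := denom_neq0 dA z0; have E := Im_moebius dA z0.
have n0 : normc (denom A z) != 0 by rewrite gt_eqF// normc_gt0.
have i0 := upper_moebius dA z0; rewrite /upper_half_plane/= in i0 z0.
have -> : z * denom A z - ((A 0 0)%:C * z + (A 0 1)%:C)%C = (z - moebius A z) * denom A z.
  by rewrite mulrBl /moebius divfK.
rewrite Normc.normcM /displacement.
move: E n0 i0; move: (Im (moebius A z)) (normc (denom A z)) => w n <- n0 w0.
by field; rewrite n0 gt_eqF.
Qed.

(** In the frame at [z], where [z] becomes [i], the squares of the entries add
up to [2 cosh d]. *)
Lemma displacement_entries A (x y : R) : \det A = 1 -> 0 < y ->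
  (A 0 0 - A 1 0 * x) ^+ 2 + (A 1 1 + A 1 0 * x) ^+ 2 + (A 1 0 * y) ^+ 2 +
  ((A 0 1 + x * (A 0 0 - A 1 1) - A 1 0 * x ^+ 2) / y) ^+ 2 =
  2 + 2 * displacement (x +i* y)%C (moebius A (x +i* y)%C).
Proof.
move=> dA y0; rewrite displacement_moebius// sqr_normcE /denom.
move: dA; rewrite det2E; move: (A 0 0) (A 0 1) (A 1 0) (A 1 1) => a b c d dA /=.
rewrite !(mul0r, subr0, addr0, add0r).
have -> : (2 : R) = 2 * (a * d - b * c) by rewrite dA mulr1.
by field; rewrite dA; apply/andP; split; rewrite ?gt_eqF//.
Qed.

Lemma sqr_le_normr (u v : R) : 0 <= v -> u ^+ 2 <= v ^+ 2 -> `|u| <= v.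
Proof.
by move=> v0 uv; rewrite -(ger0_norm v0) -ler_sqr ?nnegrE// !real_normK ?num_real.
Qed.

(** Uniformly for [w] near [z], the elements moving [w] by a bounded distance stay
in a bounded part of [SL_2(R)]: the action is proper. *)
Lemma entries_bounded (z : R[i]) : upper_half_plane z ->
  exists2 d : R, 0 < d & exists M : R, forall w, normc (w - z) < d ->
    upper_half_plane w /\ forall A, \det A = 1 ->
      displacement w (moebius A w) <= 1 -> forall i j, `|A i j| <= M.
Proof.
case: z => x0 y0; rewrite /upper_half_plane/= => y00.
exists (y0 / 2); first by rewrite divr_gt0.
pose X := `|x0| + y0; pose K := 2 + 4 / y0 * X.
have X0 : 0 <= X by rewrite addr_ge0// ltW.
have c0 : 0 <= 4 / y0 by rewrite divr_ge0// ltW.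
have K0 : 0 <= K by rewrite addr_ge0// mulr_ge0.
have L0 : 0 <= 4 * y0 + X * (K + K) + 4 / y0 * X ^+ 2.
  have m1 : 0 <= 4 * y0 by rewrite mulr_ge0// ltW.
  have m2 : 0 <= X * (K + K) by rewrite mulr_ge0// addr_ge0.
  by rewrite !addr_ge0// mulr_ge0// sqr_ge0.
exists (K + (4 / y0 + (4 * y0 + X * (K + K) + 4 / y0 * X ^+ 2))) => -[x y] wd.
have /ler_normlP[x1 x2] := le_trans (normr_Re_le _) (ltW wd).
have /ler_normlP[y1 y2] := le_trans (normr_Im_le _) (ltW wd).
move: x1 x2 y1 y2 => /= x1 x2 y1 y2.
have xX : `|x| <= X.
  rewrite -[x](subrK x0); apply: le_trans (ler_normD _ _) _; rewrite addrC lerD2l.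
  by apply/ler_normlP; split; lra.
have y_gt0 : 0 < y by lra.
split=> // A dA; have := displacement_entries x dA y_gt0.
set D := displacement _ _; move: (A 0 0) (A 1 1) (A 1 0) (A 0 1) (mat2E A) => a d c b AE E D1.
have S0 (u : R) : 0 <= u ^+ 2 := sqr_ge0 u.
have le2 (u v : R) : 0 <= v -> u ^+ 2 + v = 2 + 2 * D -> `|u| <= 2.
  by move=> v0 uv; apply: sqr_le_normr => //; lra.
set t1 := a - c * x in E; set t2 := d + c * x in E.
set t4 := (_ / y) in E; set t3 := c * y in E.
have h1 : `|t1| <= 2 by apply: (le2 _ (t2 ^+ 2 + t3 ^+ 2 + t4 ^+ 2)); [rewrite !addr_ge0|rewrite -E; ring].
have h2 : `|t2| <= 2 by apply: (le2 _ (t1 ^+ 2 + t3 ^+ 2 + t4 ^+ 2)); [rewrite !addr_ge0|rewrite -E; ring].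
have h3 : `|t3| <= 2 by apply: (le2 _ (t1 ^+ 2 + t2 ^+ 2 + t4 ^+ 2)); [rewrite !addr_ge0|rewrite -E; ring].
have h4 : `|t4| <= 2 by apply: (le2 _ (t1 ^+ 2 + t2 ^+ 2 + t3 ^+ 2)); [rewrite !addr_ge0|rewrite -E; ring].
have hc : `|c| <= 4 / y0.
  rewrite ler_pdivlMr//; move: h3; rewrite /t3 normrM (gtr0_norm y_gt0) => h3.
  have : `|c| * (y0 / 2) <= `|c| * y by apply: ler_wpM2l => //; lra.
  by lra.
have hcx : `|c * x| <= 4 / y0 * X by rewrite normrM; apply: ler_pM.
have ha : `|a| <= K.
  by rewrite -[a](subrK (c * x)); apply: le_trans (ler_normD _ _) (lerD h1 hcx).
have hd : `|d| <= K.
  by rewrite -[d](addrK (c * x)); apply: le_trans (ler_normB _ _) (lerD h2 hcx).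
have hb : `|b| <= 4 * y0 + X * (K + K) + 4 / y0 * X ^+ 2.
  have bE : b = t4 * y - x * (a - d) + c * x ^+ 2 by rewrite /t4 divfK ?gt_eqF//; ring.
  rewrite bE; apply: le_trans (ler_normD _ _) _; apply: lerD; last first.
    rewrite normrM normrX; apply: ler_pM => //.
    by rewrite ler_pXn2r ?nnegrE.
  apply: le_trans (ler_normB _ _) _; apply: lerD.
    rewrite normrM (gtr0_norm y_gt0) (_ : 4 * y0 = 2 * (2 * y0)); last by ring.
    by apply: ler_pM => //; [exact: ltW|lra].
  rewrite normrM; apply: ler_pM => //; apply: le_trans (ler_normB _ _) _.
  exact: lerD.
by rewrite AE; apply: ord2_forall; rewrite !mxE/=; lra.
Qed.

Lemma displacement_ge0 z w : upper_half_plane z -> upper_half_plane w ->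
  0 <= displacement z w.
Proof.
rewrite /upper_half_plane/= => z0 w0.
by rewrite divr_ge0 ?sqr_ge0// !mulr_ge0 ?(ltW z0) ?(ltW w0).
Qed.

Lemma psl2_exp G A n : psl2_set G A -> psl2_set G (A ^+ n).
Proof.
move=> GA; elim: n => [|n IH]; first by rewrite expr0; exact: psl2_1.
by rewrite exprS; exact: psl2_mul.
Qed.

(** The powers of an element fixing a point stay bounded, so two of them agree. *)
Lemma stabilizer_trivial G A z : fuchsian G -> torsion_free G ->
  psl2_set G A -> upper_half_plane z -> moebius A z = z -> psl2_trivial A.
Proof.
move=> fG tG GA z0 Az.
have [d d0 [M bM]] := entries_bounded z0.
have [|_ {}bM] := bM z; first by rewrite subrr Normc.normc0.
have Anz n : moebius (A ^+ n) z = z.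
  elim: n => [|n IH]; first by rewrite expr0 moebius1.
  by rewrite exprS moebiusM// ?IH//; apply: psl2_det; [exact: GA|exact: psl2_exp GA].
have Anb n : bounded_part G M (A ^+ n).
  split; first exact: psl2_exp.
  apply: bM; first by apply: psl2_det; exact: psl2_exp GA.
  by rewrite Anz /displacement subrr Normc.normc0 expr0n mul0r.
have [inj|ninj] := pselect (injective (fun n => A ^+ n)).
  exfalso; apply: infinite_nat.
  have injT : {in [set: nat] &, injective (fun n => A ^+ n)} by move=> n m _ _; exact: inj.
  rewrite -(eq_finite_set (inj_card_eq injT)).
  by apply: sub_finite_set (finite_bounded_part M fG) => _ [n _ <-].
have [n [m [nm Anm]]] : exists n m, (n < m)%N /\ A ^+ n = A ^+ m.
  apply: contrapT => H; apply: ninj => n m E; apply/eqP; case: ltngtP => // nm.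
    by case: H; exists n, m.
  by case: H; exists m, n.
apply: (tG A (m - n)%N GA); first by rewrite subn_gt0.
left; have uA := unit_det1 (psl2_det (psl2_exp n GA)).
by apply: (mulrI uA); rewrite mulr1 -exprD subnKC// ltnW.
Qed.

End DiscreteGroups.

(** * Positivity of the injectivity radius *)
Section InjectivityRadius.
Context {R : realType}.
Local Notation normc := (@Normc.normc R).
Local Notation Im := (@complex.Im R).
Implicit Types (G : psl2_subgroup R) (A B : 'M[R]_2) (z w : R[i]).

Lemma upper_near z w : upper_half_plane z -> normc (w - z) < Im z ->
  upper_half_plane w.
Proof.
rewrite /upper_half_plane/= => z0 wz.
have := le_lt_trans (normr_Im_le _) wz; case: z w {wz} z0 => x y [u v] /= y0.
by move=> /ltr_normlP[? ?]; lra.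
Qed.

Lemma moebiusB A z w : \det A = 1 -> upper_half_plane z -> upper_half_plane w ->
  moebius A w - moebius A z = (w - z) / (denom A w * denom A z).
Proof.
move=> dA z0 w0; have dz := denom_neq0 dA z0; have dw := denom_neq0 dA w0.
rewrite /moebius -mulNr addf_div// mulNr; congr (_ / _); rewrite /denom.
have : ((A 0 0)%:C * (A 1 1)%:C - (A 0 1)%:C * (A 1 0)%:C = 1)%C.
  by rewrite -!rmorphM -rmorphB -det2E dA rmorph1.
move: (_%:C)%C (_%:C)%C (_%:C)%C (_%:C)%C => a d b c E.
by rewrite -[RHS]mul1r -E; ring.
Qed.

Lemma displacement_invariant A z w : \det A = 1 ->
  upper_half_plane z -> upper_half_plane w ->
  displacement (moebius A z) (moebius A w) = displacement z w.
Proof.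
move=> dA z0 w0; have dz := denom_neq0 dA z0; have dw := denom_neq0 dA w0.
have Az := upper_moebius dA z0; have Aw := upper_moebius dA w0.
have Ez := Im_moebius dA z0; have Ew := Im_moebius dA w0.
rewrite /displacement moebiusB// Normc.normcM Normc.normcV Normc.normcM -{}Ez -{}Ew.
move: dz dw Az Aw; rewrite -!normc_gt0 /upper_half_plane/=.
move=> /gt_eqF dz /gt_eqF dw /gt_eqF Az /gt_eqF Aw.
by field; rewrite dz dw Az Aw.
Qed.

Lemma moebius_continuous A z e : \det A = 1 -> upper_half_plane z -> 0 < e ->
  exists2 d : R, 0 < d & forall w, normc (w - z) < d ->
    upper_half_plane w /\ normc (moebius A w - moebius A z) < e.
Proof.
move=> dA z0 e0; have := denom_neq0 dA z0; rewrite -normc_gt0 => dz.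
set n := normc (denom A z) in dz *; pose k := `|A 1 0| + 1.
have k0 : 0 < k by rewrite ltr_wpDl.
have d10 : 0 < n / (2 * k) by rewrite divr_gt0// mulr_gt0.
have d20 : 0 < e * n ^+ 2 / 2 by rewrite divr_gt0// mulr_gt0// exprn_gt0.
exists (Num.min (Im z) (Num.min (n / (2 * k)) (e * n ^+ 2 / 2))).
  by rewrite !lt_min d10 d20 !andbT.
move=> w; rewrite !lt_min => /and3P[w1 w2 w3].
have w0 := upper_near z0 w1; split => //.
have dw : n / 2 <= normc (denom A w).
  have -> : denom A w = denom A z + (A 1 0)%:C%C * (w - z) by rewrite /denom; ring.
  have : normc ((A 1 0)%:C%C * (w - z)) <= n / 2.
    rewrite Normc.normcM (_ : normc _ = `|A 1 0|); last first.
      by rewrite /= expr0n addr0 sqrtr_sqr.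
    have : k * normc (w - z) <= n / 2.
      by move: w2; rewrite invfM mulrA ltr_pdivlMr// mulrC => /ltW.
    rewrite /k mulrDl mul1r; have := normc_ge0 (w - z); lra.
  have := le_normcD (denom A z + (A 1 0)%:C%C * (w - z)) (- ((A 1 0)%:C%C * (w - z))).
  by rewrite addrK normcN -/n; lra.
rewrite moebiusB// Normc.normcM Normc.normcV Normc.normcM -/n.
have dw0 : 0 < normc (denom A w) by lra.
rewrite ltr_pdivrMr ?mulr_gt0//; apply: lt_le_trans w3 _.
rewrite -mulrA ler_pM2l// expr2 mulrAC; apply: ler_wpM2r; lra.
Qed.

(** By continuity of the displacement, in the explicit form which survives taking
finite minima. *)
Lemma displacement_lower_bound A z : \det A = 1 -> upper_half_plane z ->
  moebius A z <> z -> exists e d : R, [/\ 0 < e, 0 < d & forall w,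
    normc (w - z) < d -> e <= displacement w (moebius A w)].
Proof.
move=> dA z0 Az; pose p := normc (moebius A z - z).
have p0 : 0 < p by rewrite normc_gt0 subr_eq0; exact/eqP.
pose k := Num.min 1 (p / 4); have k0 : 0 < k by rewrite lt_min ltr01 divr_gt0.
have [k1 kp] : k <= 1 /\ k <= p / 4 by rewrite !ge_min !lexx orbT.
have [d d0 dP] := moebius_continuous dA z0 k0.
have Az0 := upper_moebius dA z0; rewrite /upper_half_plane/= in z0 Az0.
have m1 : 0 < Im z + 1 by rewrite ltr_wpDr.
have m2 : 0 < Im (moebius A z) + 1 by rewrite ltr_wpDr.
exists ((p / 2) ^+ 2 / (2 * (Im z + 1) * (Im (moebius A z) + 1))), (Num.min d k).
split; first by rewrite divr_gt0 ?exprn_gt0 ?mulr_gt0// divr_gt0.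
  by rewrite lt_min d0.
move=> w; rewrite lt_min => /andP[wd wk]; have [w0 Awz] := dP w wd.
have Aw0 := upper_moebius dA w0; rewrite /upper_half_plane/= in w0 Aw0.
have i1 : Im w <= Im z + 1.
  have /ler_normlP[_] := le_trans (normr_Im_le _) (ltW wk).
  by rewrite raddfB/=; lra.
have i2 : Im (moebius A w) <= Im (moebius A z) + 1.
  have /ler_normlP[_] := le_trans (normr_Im_le _) (ltW Awz).
  by rewrite raddfB/=; lra.
have pw : p / 2 <= normc (w - moebius A w).
  have := le_normcD (moebius A z - moebius A w) (moebius A w - w + (w - z)).
  have := le_normcD (moebius A w - w) (w - z).
  rewrite addrA addrA subrK subrK -/p -[moebius A z - _]opprB normcN.
  by rewrite -[moebius A w - w]opprB normcN; lra.
rewrite /displacement ler_pM ?invr_ge0 ?exprn_ge0 ?divr_ge0 ?mulr_ge0 ?(ltW p0) ?(ltW m1) ?(ltW m2)//.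
  by rewrite ler_pXn2r ?nnegrE ?normc_ge0 ?divr_ge0 ?(ltW p0).
rewrite lef_pV2 ?posrE ?mulr_gt0//; apply: ler_pM; rewrite ?mulr_ge0 ?(ltW w0) ?(ltW Aw0)//.
by rewrite ler_pM2l.
Qed.

(** Only finitely many elements move a point near [z] by less than 1, and each of
them, having no fixed point, moves all points near [z] by a definite amount. *)
Lemma displacement_local G z : fuchsian G -> torsion_free G ->
  upper_half_plane z -> exists e d : R, [/\ 0 < e, 0 < d & forall w A,
    normc (w - z) < d -> psl2_set G A -> ~ psl2_trivial A ->
    e <= displacement w (moebius A w)].
Proof.
move=> fG tG z0; have [d d0 [M bM]] := entries_bounded z0.
pose S := bounded_part G M `&` [set A | ~ psl2_trivial A].
have : finite_set S by apply: sub_finite_set (finite_bounded_part M fG) => A [].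
move=> /finite_seqP[s Ss].
have [e [d' [e0 d'0 eP]]] : exists e d : R, [/\ 0 < e, 0 < d & forall w A,
    normc (w - z) < d -> A \in s -> e <= displacement w (moebius A w)].
  have sG A : A \in s -> psl2_set G A /\ ~ psl2_trivial A.
    by move=> As; have : S A by [rewrite Ss]; move=> [[]].
  elim: s sG {Ss} => [|A s IH] sG; first by exists 1, 1.
  have [|e1 [d1 [e10 d10 P1]]] := IH; first by move=> B Bs; apply: sG; rewrite inE Bs orbT.
  have [GA nA] := sG A (mem_head _ _).
  have [|e2 [d2 [e20 d20 P2]]] := displacement_lower_bound (psl2_det GA) z0.
    by move=> Az; apply: nA; exact: stabilizer_trivial fG tG GA z0 Az.
  exists (Num.min e1 e2), (Num.min d1 d2); rewrite !lt_min e10 e20 d10 d20; split => // w B.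
  rewrite lt_min => /andP[w1 w2]; rewrite inE ge_min => /orP[/eqP ->|Bs].
    by rewrite P2 ?orbT.
  by rewrite P1.
exists (Num.min 1 e), (Num.min d d'); rewrite !lt_min ltr01 e0 d0 d'0; split => // w A.
rewrite lt_min => /andP[w1 w2] GA nA; rewrite ge_min.
have [//|lt1] := leP 1 (displacement w (moebius A w)).
rewrite /= eP//; suff : [set` s] A by [].
rewrite -Ss; split => //; split => //.
by apply: (bM w w1).2; [exact: psl2_det GA|exact: ltW].
Qed.

(** Compactness of the quotient, for an increasing sequence of invariant open
subsets of the half-plane. *)
Lemma cocompact_exhaustion G (V : nat -> set R[i]) : cocompact G ->
  (forall n z, V n z -> exists2 d : R, 0 < d & forall w, normc (w - z) < d -> V n w) ->
  (forall n A z, psl2_set G A -> upper_half_plane z -> V n z -> V n (moebius A z)) ->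
  (forall m n, (m <= n)%N -> V m `<=` V n) ->
  (forall z, upper_half_plane z -> exists n, V n z) ->
  exists n, forall z, upper_half_plane z -> V n z.
Proof.
move=> cG Vopen Vinv Vmono Vcover.
pose O n : set (surface G) := [set x | V n (set_val (repr x))].
pose pr (z : upper_half_plane (R := R)) : surface G := \pi_(surface G)%qT z.
have uv (z : upper_half_plane (R := R)) : upper_half_plane (set_val z).
  exact: set_valP.
have OV n (z : upper_half_plane (R := R)) : O n (pr z) <-> V n (set_val z).
  have zr : same_orbit G z (repr (pr z)).
    by apply/eqmodP; rewrite reprK.
  move: zr => /asboolP[A GA E]; rewrite /O/= E; split => [|Vz]; last exact: Vinv.
  by move=> /(Vinv n A^-1 _ (psl2_inv GA)); rewrite (moebiusVK GA)//; apply; exact: upper_moebius (psl2_det GA) _.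
have Oopen n : open (O n).
  rewrite /open/= /quotient_open.
  rewrite (_ : _ @^-1` O n = set_val @^-1` (V n : set R[i]^o)); last first.
    by apply/seteqP; split => z /OV.
  exists (V n : set R[i]^o) => //; rewrite openE => z /Vopen[d d0 dP].
  by apply/nbhs_complexP; exists d.
(* a neighbourhood of the class of [x] lies in [O n] for all large [n] *)
have cov x : [set: surface G] x -> \forall x' \near x & n \near \oo, O n x'.
  move=> _; have [n Vn] := Vcover _ (uv (repr x)).
  exists (O n, [set k | (n <= k)%N]) => /=.
    split; last by exists n.
    exact: (open_nbhs_nbhs (conj (Oopen n) Vn)).
  by move=> [x' k] [/= Ox' nk]; exact: Vmono Ox'.
have [n _ nP] := (compact_near_coveringP [set: surface G]).1 cG nat \oo O _ cov.
exists n => z z0.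
pose z' : upper_half_plane (R := R) := SigSub (mem_set z0).
by have := (OV n z').1 (nP n (leqnn n) (pr z') I).
Qed.

End InjectivityRadius.

Section RadiusPositive.
Context {R : realType}.
Local Notation normc := (@Normc.normc R).
Local Notation Im := (@complex.Im R).
Implicit Types (G : psl2_subgroup R) (A B : 'M[R]_2) (z w : R[i]).

Lemma moebius_trivial A z : psl2_trivial A -> moebius A z = z.
Proof.
case=> ->; first exact: moebius1.
rewrite /moebius /denom !mxE/= !(mulr1n, mulr0n) oppr0 !rmorphN1 rmorph0.
by rewrite mul0r addr0 add0r mulN1r invrN1 mulrN1 opprK.
Qed.

(** The displacement functions are bounded below near each point and their infimum
over the group is invariant, so compactness of the quotient makes the lower
bound uniform. *)
Lemma displacement_uniform G : fuchsian G -> torsion_free G -> cocompact G ->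
  exists2 e : R, 0 < e & forall z A, upper_half_plane z -> psl2_set G A ->
    ~ psl2_trivial A -> e <= displacement z (moebius A z).
Proof.
move=> fG tG cG.
pose W n z := upper_half_plane z /\ forall A, psl2_set G A -> ~ psl2_trivial A ->
  n.+1%:R^-1 <= displacement z (moebius A z).
(* the interior of [W n], as the exhaustion has to be open *)
pose V n : set R[i] := [set z | exists2 d : R, 0 < d &
  forall w, normc (w - z) < d -> W n w].
(* conjugation by [A] permutes the nontrivial elements *)
have Winv n A z : psl2_set G A -> W n z -> W n (moebius A z).
  move=> GA [z0 Wz]; have dA := psl2_det GA; split; first exact: upper_moebius.
  move=> B GB nB; pose C := A^-1 * (B * A).
  have GC : psl2_set G C by apply: psl2_mul (psl2_inv GA) (psl2_mul GB GA).
  have uA := unit_det1 dA.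
  have BE : B = A * C * A^-1 by rewrite /C mulVKr// mulrK.
  have nC : ~ psl2_trivial C.
    by move=> [] C1; apply: nB; [left|right]; rewrite BE C1 ?mulr1 ?mulrN ?mulNr ?mulr1 divrr.
  have dB := psl2_det GB; have dC := psl2_det GC.
  have -> : moebius B (moebius A z) = moebius A (moebius C z).
    by rewrite -!moebiusM// /C mulVKr.
  rewrite displacement_invariant//; first exact: Wz.
  exact: upper_moebius.
have [||||n nV] := @cocompact_exhaustion R G V cG.
- move=> n z [d d0 dP]; exists (d / 2); first by rewrite divr_gt0.
  move=> w wz; exists (d / 2); first by rewrite divr_gt0.
  move=> v vw; apply: dP; rewrite -[v](subrK w) -addrA.
  by apply: le_lt_trans (le_normcD _ _) _; lra.
- move=> n A z GA z0 [d d0 dP].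
  have Az0 := upper_moebius (psl2_det GA) z0.
  have [e e0 eP] := moebius_continuous (psl2_det (psl2_inv GA)) Az0 d0.
  exists e => // w /eP[w0]; rewrite (moebiusVK GA z0) => /dP Ww.
  by rewrite -(moebiusKV GA w0); exact: Winv.
- move=> m n mn z [d d0 dP]; exists d => // w /dP[w0 Ww]; split => // A GA nA.
  by apply: le_trans (Ww A GA nA); rewrite lef_pV2 ?posrE// ler_nat ltnS.
- move=> z z0; have [e [d [e0 d0 edP]]] := displacement_local fG tG z0.
  exists (Num.bound e^-1), (Num.min d (Im z)); first by rewrite lt_min d0.
  move=> w; rewrite lt_min => /andP[wd wI]; split; first exact: upper_near wI.
  move=> A GA nA; apply: le_trans (edP w A wd GA nA).
  rewrite invf_ple ?posrE//; apply: ltW; apply: lt_trans (archi_boundP _) _.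
    by rewrite invr_ge0 ltW.
  by rewrite ltr_nat.
exists n.+1%:R^-1; first by rewrite invr_gt0.
move=> z A z0 GA nA; have [d d0 dP] := nV z z0.
by apply: (dP z _).2 => //; rewrite subrr Normc.normc0.
Qed.

(** The half-plane itself is not compact: the sets [1 / (n + 1) < Im z] exhaust it,
and they are invariant if the group acts trivially. *)
Lemma cocompact_nontrivial G : cocompact G ->
  exists2 A, psl2_set G A & ~ psl2_trivial A.
Proof.
move=> cG; apply: contrapT => H.
have triv A : psl2_set G A -> psl2_trivial A.
  by move=> GA; apply: contrapT => nA; apply: H; exists A.
pose V n : set R[i] := [set z | n.+1%:R^-1 < Im z].
have [||||n nV] := @cocompact_exhaustion R G V cG.
- move=> n z Vz; exists (Im z - n.+1%:R^-1); first by rewrite subr_gt0.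
  move=> w /(le_lt_trans (normr_Im_le _)) /ltr_normlP[]; rewrite raddfB/= /V/=.
  by set k := _^-1; lra.
- by move=> n A z GA z0; rewrite (moebius_trivial _ (triv A GA)).
- move=> m n mn z; apply: le_lt_trans.
  by rewrite lef_pV2 ?posrE// ler_nat ltnS.
- move=> z; rewrite /upper_half_plane/= => z0; exists (Num.bound (Im z)^-1).
  rewrite /V/= invf_plt ?posrE//; apply: lt_trans (archi_boundP _) _.
    by rewrite invr_ge0 ltW.
  by rewrite ltr_nat.
have := nV (0 +i* (n.+1%:R^-1))%C; rewrite /upper_half_plane/= /V/= ltxx.
by rewrite invr_gt0 ltr0n => /(_ isT).
Qed.

Lemma arcosh_ge (e t : R) : 0 <= e -> 1 + e <= t -> ln (1 + e) <= arcosh t.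
Proof.
move=> e0 et; rewrite /arcosh ler_ln ?posrE; [|lra|].
  by apply: le_trans et _; rewrite lerDl sqrtr_ge0.
by apply: lt_le_trans (_ : t <= _); [lra|rewrite lerDl sqrtr_ge0].
Qed.

Lemma arcosh_lt (r t : R) : 1 <= t -> 0 < r -> t < (expR r + expR (- r)) / 2 ->
  arcosh t < r.
Proof.
move=> t1 r0 tr; pose s := (expR r - expR (- r)) / 2.
have e1 : expR r * expR (- r) = 1 by rewrite expRxMexpNx_1.
have s0 : 0 < s by rewrite divr_gt0// subr_gt0 ltr_expR; lra.
have lts : Num.sqrt (t ^+ 2 - 1) < s.
  rewrite -(ger0_norm (ltW s0)) -sqrtr_sqr ltr_sqrt ?exprn_gt0//.
  have : t ^+ 2 < ((expR r + expR (- r)) / 2) ^+ 2 by rewrite ltr_pXn2r ?nnegrE//; lra.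
  have -> : s ^+ 2 = ((expR r + expR (- r)) / 2) ^+ 2 - expR r * expR (- r).
    by rewrite /s; field.
  by rewrite e1; lra.
have t0 : 0 < t + Num.sqrt (t ^+ 2 - 1) by rewrite ltr_pwDl ?sqrtr_ge0//; lra.
by rewrite /arcosh -ltr_expR lnK//; move: lts; rewrite /s; lra.
Qed.

Lemma hdistE z w : hdist z w = arcosh (1 + displacement z w).
Proof. by []. Qed.

Lemma hdist_ge0 z w : upper_half_plane z -> upper_half_plane w -> 0 <= hdist z w.
Proof.
move=> z0 w0; rewrite hdistE -[leLHS](@ln1 R) -[in X in X <= _](addr0 1).
by apply: arcosh_ge => //; rewrite lerD2l displacement_ge0.
Qed.

Lemma injectivity_radius_le G z A : upper_half_plane z -> psl2_set G A ->
  ~ psl2_trivial A -> injectivity_radius G <= hdist z (moebius A z).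
Proof.
move=> z0 GA nA; apply: ge_inf; last by exists z, A.
exists 0 => _ [w [B [w0 GB _ ->]]]; apply: hdist_ge0 => //.
exact: upper_moebius (psl2_det GB) w0.
Qed.

(** The group has a nontrivial element, so the infimum is not over the empty set,
for which it would be 0. *)
Lemma injectivity_radius_gt0 G : fuchsian G -> torsion_free G -> cocompact G ->
  0 < injectivity_radius G.
Proof.
move=> fG tG cG; have [e e0 eP] := displacement_uniform fG tG cG.
have [A GA nA] := cocompact_nontrivial cG.
apply: (@lt_le_trans _ _ (ln (1 + e))); first by apply: ln_gt0; rewrite ltrDl.
apply: lb_le_inf.
  exists (hdist (0 +i* 1)%C (moebius A (0 +i* 1)%C)), (0 +i* 1)%C, A.
  by split => //; rewrite /upper_half_plane/=.
move=> _ [z [B [z0 GB nB ->]]]; rewrite hdistE; apply: arcosh_ge; first exact: ltW.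
by rewrite lerD2l; exact: eP.
Qed.

End RadiusPositive.

(** * The section extremal at a point *)
Section ExtremalSection.
Context {R : realType}.
Local Notation normc := (@Normc.normc R).
Local Notation Im := (@complex.Im R).
Local Notation Re := (@complex.Re R).
Local Notation plane := (measurableTypeR R * measurableTypeR R)%type.
Local Notation area := (@lebesgue_measure R \x @lebesgue_measure R)%E.
Implicit Types (G : psl2_subgroup R).

Lemma cusp_form_comb G n (f : 'I_n -> R[i] -> R[i]) (c : 'I_n -> R[i]) :
  (forall j, cusp_form2 G (f j)) ->
  cusp_form2 G (fun w => \sum_(j < n) c j * f j w).
Proof.
move=> cf; split=> [z z0|A z GA z0]; last first.
  rewrite mulr_sumr; apply: eq_bigr => j _.
  by rewrite (cf j).2// mulrCA.
have -> : (fun w => \sum_(j < n) c j * f j w) =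
    \sum_(j < n) (c j \*: (f j : R[i]^o -> R[i]^o)) :> (R[i]^o -> R[i]^o).
  by apply/funext => w; rewrite fct_sumE.
by apply: derivable_sum => j; apply: derivableZ; exact: (cf j).1.
Qed.

Lemma integral_lincomb (I : finType) (A : set plane) (k l : I -> R)
    (u v : I -> plane -> R) : measurable A ->
  (forall i, area.-integrable A (EFin \o u i)) ->
  (forall i, area.-integrable A (EFin \o v i)) ->
  (\int[area]_(p in A) (\sum_i (k i * u i p - l i * v i p))%:E =
   (\sum_i (k i * (\int[area]_(p in A) u i p)%R - l i * (\int[area]_(p in A) v i p)%R))%:E)%E.
Proof.
move=> mA iu iv.
have ik i : area.-integrable A (fun p => (k i)%:E * (u i p)%:E)%E by exact: integrableZl (iu i).
have il i : area.-integrable A (fun p => (l i)%:E * (v i p)%:E)%E by exact: integrableZl (iv i).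
transitivity (\int[area]_(p in A) \sum_i ((k i)%:E * (u i p)%:E - (l i)%:E * (v i p)%:E))%E.
  by apply: eq_integral => p _; rewrite -sumEFin.
rewrite integral_sum//; last by move=> i; exact: integrableB (ik i) (il i).
rewrite -sumEFin; apply: eq_bigr => i _.
rewrite integralB// (integralZl mA (iu i)) (integralZl mA (iv i)) EFinB !EFinM.
by rewrite /Rintegral !fineK//; [exact: integrable_fin_num (iv i)|exact: integrable_fin_num (iu i)].
Qed.

(** The real-valued integral is 0 when the integral diverges, hence a nonzero value
certifies convergence. *)
Lemma Rintegral_neq0_integrable (A : set plane) (u : plane -> R) : measurable A ->
  measurable_fun A (u : plane -> measurableTypeR R) -> (forall p, 0 <= u p) ->
  (\int[area]_(p in A) u p)%R != 0 -> area.-integrable A (EFin \o u).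
Proof.
move=> mA mu u0; rewrite /Rintegral => n0; apply/integrableP; split.
  exact/measurable_EFinP.
under eq_integral => p _ do rewrite /= ger0_norm//.
have : (0 <= \int[area]_(p in A) (u p)%:E)%E by apply: integral_ge0 => p _; rewrite lee_fin.
move: n0; case: (integral _ _ _) => //=; last by rewrite eqxx.
by move=> r _ _; rewrite ltry.
Qed.

Lemma mul_conjE (a b : R[i]) :
  (Re (a * b^*%C) = Re a * Re b + Im a * Im b) /\
  (Im (a * b^*%C) = Im a * Re b - Re a * Im b).
Proof. by case: a b => a a' [b b'] /=; split; ring. Qed.

Lemma norm_mul_conj (a b : R[i]) :
  `|Re (a * b^*%C)| <= normc a ^+ 2 + normc b ^+ 2 /\
  `|Im (a * b^*%C)| <= normc a ^+ 2 + normc b ^+ 2.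
Proof.
have [-> ->] := mul_conjE a b; rewrite !sqr_normcE.
move: (Re a) (Im a) (Re b) (Im b) => x y u v.
have := sqr_ge0 (x + u); have := sqr_ge0 (x - u); have := sqr_ge0 (y + v).
have := sqr_ge0 (y - v); have := sqr_ge0 (x + v); have := sqr_ge0 (x - v).
have := sqr_ge0 (y + u); have := sqr_ge0 (y - u).
by split; apply/ler_normlP; split; nra.
Qed.

(** Pythagoras' theorem. The products [f j * f k^*] are integrable because the
norms of the [f j] are equal to 1 and thus come from convergent integrals. *)
Lemma orthonormal_norm G (D : set R[i]) n (f : 'I_n -> R[i] -> R[i]) (c : 'I_n -> R[i]) :
  measurable (coords D) -> D `<=` upper_half_plane ->
  (forall j, cusp_form2 G (f j)) ->
  (forall j k, petersson D (f j) (f k) = (j == k)%:R) ->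
  (\int[area]_(p in coords D) (normc (\sum_(j < n) c j * f j (p.1 +i* p.2)%C) ^+ 2)%:E =
   (\sum_(j < n) normc (c j) ^+ 2)%:E)%E.
Proof.
move=> mD DH cf on.
have Rlip (u v : R[i]) : `|Re u - Re v| <= normc (u - v) by rewrite -raddfB normr_Re_le.
have Ilip (u v : R[i]) : `|Im u - Im v| <= normc (u - v) by rewrite -raddfB normr_Im_le.
have restr (u : plane -> measurableTypeR R) :
    measurable_fun ([set p | 0 < p.2] : set plane) u -> measurable_fun (coords D) u.
  by move=> um; apply: measurable_funS um => //; [exact: measurable_upper|move=> p /DH].
have mRe j := restr _ (cusp_form_coordinate (cf j) Rlip).
have mIm j := restr _ (cusp_form_coordinate (cf j) Ilip).
pose prod (q : 'I_n * 'I_n) (p : plane) : R[i] :=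
  f q.1 (p.1 +i* p.2)%C * (f q.2 (p.1 +i* p.2)%C)^*%C.
have mRp q : measurable_fun (coords D) (fun p => Re (prod q p) : measurableTypeR R).
  under eq_fun => p do rewrite (mul_conjE _ _).1.
  by apply: measurable_funD; apply: measurable_funM; by [exact: mRe|exact: mIm].
have mIp q : measurable_fun (coords D) (fun p => Im (prod q p) : measurableTypeR R).
  under eq_fun => p do rewrite (mul_conjE _ _).2.
  by apply: measurable_funB; apply: measurable_funM; by [exact: mRe|exact: mIm].
have onR q : (\int[area]_(p in coords D) Re (prod q p))%R = (q.1 == q.2)%:R.
  by have := congr1 Re (on q.1 q.2); rewrite /petersson /area_integral/= => ->; case: eqP.
have onI q : (\int[area]_(p in coords D) Im (prod q p))%R = 0.
  by have := congr1 Im (on q.1 q.2); rewrite /petersson /area_integral/= => ->; case: eqP.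
have sqE j (p : plane) : Re (prod (j, j) p) = normc (f j (p.1 +i* p.2)%C) ^+ 2.
  by rewrite (mul_conjE _ _).1 sqr_normcE !expr2.
have isq j : area.-integrable (coords D)
    (EFin \o (fun p => normc (f j (p.1 +i* p.2)%C) ^+ 2)).
  have := @Rintegral_neq0_integrable (coords D) (fun p => Re (prod (j, j) p)) mD (mRp (j, j)).
  rewrite onR eqxx oner_neq0 => /(_ _ isT).
  have -> : (fun p => Re (prod (j, j) p)) = (fun p => normc (f j (p.1 +i* p.2)%C) ^+ 2).
    by apply/funext => p; exact: sqE.
  by apply => p; rewrite sqE sqr_ge0.
have isum q := integrableD mD (isq q.1) (isq q.2).
have iR q : area.-integrable (coords D) (EFin \o (fun p => Re (prod q p))).
  apply: le_integrable (isum q) => //; first by apply/measurable_EFinP; exact: mRp.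
  move=> p _ /=; rewrite lee_fin [leRHS]ger0_norm ?addr_ge0 ?sqr_ge0//.
  exact: (norm_mul_conj _ _).1.
have iI q : area.-integrable (coords D) (EFin \o (fun p => Im (prod q p))).
  apply: le_integrable (isum q) => //; first by apply/measurable_EFinP; exact: mIp.
  move=> p _ /=; rewrite lee_fin [leRHS]ger0_norm ?addr_ge0 ?sqr_ge0//.
  exact: (norm_mul_conj _ _).2.
pose cc (q : 'I_n * 'I_n) : R[i] := c q.1 * (c q.2)^*%C.
transitivity (\int[area]_(p in coords D)
    (\sum_q (Re (cc q) * Re (prod q p) - Im (cc q) * Im (prod q p)))%:E)%E.
  apply: eq_integral => p _; congr (_%:E).
  have -> (s : R[i]) : normc s ^+ 2 = Re (s * s^*%C).
    by rewrite (mul_conjE _ _).1 sqr_normcE !expr2.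
  have -> : (\sum_(j < n) c j * f j (p.1 +i* p.2)%C) *
      (\sum_(j < n) c j * f j (p.1 +i* p.2)%C)^*%C = \sum_q cc q * prod q p.
    rewrite rmorph_sum mulr_suml -(pair_bigA _ (fun j k => cc (j, k) * prod (j, k) p)).
    apply: eq_bigr => j _; rewrite mulr_sumr; apply: eq_bigr => k _.
    by rewrite rmorphM mulrACA.
  rewrite raddf_sum; apply: eq_bigr => q _.
  by case: (cc q) (prod q p) => ? ? [].
rewrite integral_lincomb//; congr (_%:E).
under eq_bigr => q _ do rewrite onR onI mulr0 subr0.
rewrite -(pair_bigA _ (fun j k => Re (cc (j, k)) * (j == k)%:R))/=.
apply: eq_bigr => j _; rewrite (bigD1 j)//= eqxx mulr1 big1 ?addr0.
  by rewrite /cc/= (mul_conjE _ _).1 sqr_normcE !expr2.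
by move=> k kj; rewrite eq_sym (negbTE kj) mulr0.
Qed.

End ExtremalSection.

(** * The pointwise bound *)
Section PointwiseBound.
Context {R : realType}.
Local Notation normc := (@Normc.normc R).
Local Notation Im := (@complex.Im R).
Local Notation Re := (@complex.Re R).
Local Notation plane := (measurableTypeR R * measurableTypeR R)%type.
Local Notation area := (@lebesgue_measure R \x @lebesgue_measure R)%E.
Implicit Types (G : psl2_subgroup R) (z w : R[i]) (a r : R).

Definition square_at z a : set R[i] :=
  [set w | `|Re w - Re z| < a /\ `|Im w - Im z| < a].

Lemma area_preserving_shift (u v : R) :
  area_preserving (fun p : R * R => (p.1 + u, p.2 + v)).
Proof.
exact: (area_preserving_comp
  (area_preserving_shear1 (b := fun=> u) (measurable_cst _))
  (area_preserving_shear2 (b := fun=> v) (measurable_cst _))).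
Qed.

Lemma measurable_square_at z a : measurable (coords (square_at z a)).
Proof.
have [m _] := area_preserving_shift (- Re z) (- Im z).
by have := m measurableT _ (measurable_square a); rewrite setTI.
Qed.

Lemma derivable_translate_sqr (F : R[i]^o -> R[i]^o) (z w : R[i]^o) :
  derivable F (z + w) 1 -> derivable (fun w : R[i]^o => F (z + w) ^+ 2 : R[i]^o) w 1.
Proof.
move=> dF; have dT : derivable (fun w : R[i]^o => F (z + w) : R[i]^o) w 1.
  have E (t : R[i]^o) : t *: (1 : R[i]^o) + (z + w) = z + (t *: (1 : R[i]^o) + w).
    exact: addrCA.
  move: dF; rewrite /derivable /=.
  have -> : (fun t : R[i]^o => t^-1 *: (F (t *: (1 : R[i]^o) + (z + w)) - F (z + w))) =
      (fun t : R[i]^o => t^-1 *: (F (z + (t *: (1 : R[i]^o) + w)) - F (z + w))).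
    by apply/funext => t; rewrite E.
  exact: id.
exact: (@derivableM _ _ _ _ w 1 dT dT).
Qed.

(** The mean value inequality is applied to the holomorphic function [F ^+ 2]. *)
Lemma square_mean_value_sqr G F z a : cusp_form2 G F -> 0 < a ->
  square_at z a `<=` upper_half_plane ->
  ((pi * a ^+ 2 * normc (F z) ^+ 2)%:E <=
   \int[area]_(p in coords (square_at z a)) (normc (F (p.1 +i* p.2)%C) ^+ 2)%:E)%E.
Proof.
move=> cF a0 QH; pose h (w : R[i]^o) : R[i]^o := F (z + w) ^+ 2.
have nX (u : R[i]) : normc (u ^+ 2) = normc u ^+ 2 by rewrite !expr2 Normc.normcM.
have := @square_mean_value R h a a0; rewrite /h addr0 nX => mv.
apply: le_trans (mv _) _ => [x y xa ya|].
  apply: derivable_translate_sqr; apply: cF.1; apply: QH.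
  by case: (z) => u v; split; rewrite /= addrAC subrr add0r.
pose f (p : plane) : \bar R := (normc (F (p.1 +i* p.2)%C) ^+ 2)%:E.
have mQ := measurable_square_at z a.
have mf : measurable_fun setT (f \_ (coords (square_at z a))).
  apply/(measurable_restrictT _ mQ).
  by apply: measurable_funS (cusp_form_measurable cF) => //; [exact: measurable_upper|move=> p /QH].
rewrite [leRHS]integral_mkcond -/f -(area_preserving_shift (Re z) (Im z)).2//; last first.
  by move=> p; apply: erestrict_ge0 => q _; rewrite lee_fin sqr_ge0.
rewrite integral_mkcond le_eqVlt; apply/orP; left; apply/eqP.
apply: eq_integral => p _; rewrite !patchE.
have -> : ((p.1 + Re z, p.2 + Im z) \in coords (square_at z a)) = (p \in square a).
  apply/idP/idP => /set_mem pQ; apply/mem_set; move: pQ;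
    by rewrite /coords /square_at /square/= !addrK.
case: ifPn => // _; rewrite nX /f; congr ((normc (F _) ^+ 2)%:E).
by case: (z) => u v /=; rewrite addrC; congr (_ +i* _)%C; rewrite addrC.
Qed.

Lemma hdist_lt w v r : upper_half_plane w -> upper_half_plane v -> 0 < r ->
  displacement w v < 2 * sinh (r / 2) ^+ 2 -> hdist w v < r.
Proof.
move=> w0 v0 r0 wv; rewrite hdistE; apply: arcosh_lt => //.
  by rewrite lerDl displacement_ge0.
have e1 : expR (r / 2) * expR (- (r / 2)) = 1 by rewrite expRxMexpNx_1.
have -> : r = r / 2 + r / 2 by lra.
rewrite opprD !expRD.
move: wv; rewrite /sinh; move: (expR (r / 2)) (expR (- (r / 2))) e1 => e e' e1 wv.
have -> : (e * e + e' * e') / 2 = e * e' + 2 * ((e - e') / 2) ^+ 2 by field.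
by rewrite e1 ltrD2l.
Qed.

(** Two points of the square are closer than any two points of an orbit. *)
Lemma square_at_injective G z a A w :
  0 < injectivity_radius G -> 0 < a -> a < Im z ->
  3 * a <= 2 * (Im z - a) * sinh (injectivity_radius G / 2) ->
  psl2_set G A -> square_at z a w -> square_at z a (moebius A w) -> moebius A w = w.
Proof.
set r := injectivity_radius G => r0 a0 az ha GA Qw Qv.
have [/moebius_trivial|nA] := pselect (psl2_trivial A); first by apply.
have upper u : square_at z a u -> Im z - a < Im u.
  by move=> [_ /ltr_normlP[? ?]]; lra.
have w0 : upper_half_plane w by have := upper _ Qw; rewrite /upper_half_plane/=; lra.
have v0 := upper_moebius (psl2_det GA) w0.
have := injectivity_radius_le w0 GA nA; rewrite leNgt => /negP; case.
apply: hdist_lt => //; rewrite /displacement sqr_normcE !raddfB/=.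
have := upper _ Qw; have := upper _ Qv.
move: Qw Qv => [/ltr_normlP[x1 x2] /ltr_normlP[y1 y2]] [/ltr_normlP[x3 x4] /ltr_normlP[y3 y4]].
rewrite -/r in ha *.
move: (moebius A w) (sinh (r / 2)) (Im z - a) (subr_gt0 a (Im z)) ha x1 x2 x3 x4 y1 y2 y3 y4 => v S t.
rewrite az; move: (Re w) (Im w) (Re v) (Im v) (Re z) (Im z) => w1 w2 v1 v2 z1 z2.
move=> t0 ha x1 x2 x3 x4 y1 y2 y3 y4 vt wt.
have sq (b c : R) : `|b| < 2 * a -> b ^+ 2 < 4 * a ^+ 2.
  move=> ba; rewrite -(real_normK (num_real b)) (_ : 4 * a ^+ 2 = (2 * a) ^+ 2); last by ring.
  by rewrite ltr_pXn2r ?nnegrE//; lra.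
have h1 : (w1 - v1) ^+ 2 < 4 * a ^+ 2 by apply: (sq _ 0); apply/ltr_normlP; split; lra.
have h2 : (w2 - v2) ^+ 2 < 4 * a ^+ 2 by apply: (sq _ 0); apply/ltr_normlP; split; lra.
have tt : t * t <= w2 * v2 by apply: ler_pM; lra.
rewrite ltr_pdivrMr; last by rewrite !mulr_gt0//; lra.
have h3 : (3 * a) ^+ 2 <= (2 * t * S) ^+ 2 by rewrite ler_pXn2r ?nnegrE//; lra.
have h4 : S ^+ 2 * (t * t) <= S ^+ 2 * (w2 * v2) by apply: ler_wpM2l => //; exact: sqr_ge0.
have h5 : 9 * a ^+ 2 <= 4 * (S ^+ 2 * (t * t)).
  by rewrite (_ : 9 * _ = (3 * a) ^+ 2) 1?(_ : 4 * _ = (2 * t * S) ^+ 2)//; ring.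
have -> : 2 * S ^+ 2 * (2 * w2 * v2) = 4 * (S ^+ 2 * (w2 * v2)) by ring.
have a2 : 0 < a ^+ 2 by rewrite exprn_gt0.
move: h1 h2 h4 h5 a2; move: (S ^+ 2 * _) (S ^+ 2 * _) (a ^+ 2) ((w1 - v1) ^+ 2) ((w2 - v2) ^+ 2).
by move=> ? ? ? ? ? *; lra.
Qed.

(** The estimate [pi a^2 L^2 <= L] for the largest [a] allowed by
[square_at_injective]. Writing [k] for the quotient of the half-side [a] by the
height [Im z - a] of the lower edge, the constraint reads
[3 k <= 2 sinh (r / 2)], and the estimate becomes
[Im z ^+ 2 * L <= (1 + 1 / k) ^+ 2 / pi]. *)
Lemma norm_bound G (D : set R[i]) F z L : fuchsian G -> torsion_free G ->
  cocompact G -> fundamental_domain G D -> upper_half_plane z ->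
  cusp_form2 G F -> 0 <= L -> normc (F z) = L ->
  (\int[area]_(p in coords D) (normc (F (p.1 +i* p.2)%C) ^+ 2)%:E <= L%:E)%E ->
  Im z ^+ 2 * L <= 48 / pi + 4 / (3 * pi * sinh (injectivity_radius G / 4) ^+ 2).
Proof.
move=> fG tG cG [mD DH Dcover _] z0 cF L0 FL FD.
have r0 := injectivity_radius_gt0 fG tG cG; rewrite /upper_half_plane/= in z0.
set r := injectivity_radius G in r0 *.
pose S := sinh (r / 4); pose C := (expR (r / 4) + expR (- (r / 4))) / 2.
have e1 : expR (r / 4) * expR (- (r / 4)) = 1 by rewrite expRxMexpNx_1.
have S0 : 0 < S by rewrite divr_gt0// subr_gt0 ltr_expR; lra.
have C0 : 0 < C by rewrite divr_gt0// addr_gt0// expR_gt0.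
have CS : C ^+ 2 = 1 + S ^+ 2 by rewrite -e1 /C /S /sinh; field.
have dbl : sinh (r / 2) = 2 * S * C.
  rewrite {1}/sinh (_ : r / 2 = r / 4 + r / 4); last by lra.
  by rewrite opprD !expRD /S /C /sinh; field.
pose k := 2 * sinh (r / 2) / 3.
have SC0 : 0 < S * C by exact: mulr_gt0 S0 C0.
have k0 : 0 < k by rewrite /k dbl; move: (S) (C) SC0 => s c sc0; lra.
pose a := Im z * (k / (1 + k)).
have k10 : 0 < 1 + k by rewrite addr_gt0.
have a0 : 0 < a by rewrite mulr_gt0// divr_gt0.
have yaE : a = k * (Im z - a) by rewrite /a; field; rewrite gt_eqF.
have ya : 0 < Im z - a by rewrite -(pmulr_rgt0 _ k0) -yaE.
have QH : square_at z a `<=` upper_half_plane.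
  by move=> w [_ /ltr_normlP[? ?]]; rewrite /upper_half_plane/=; lra.
have Qinj A w : psl2_set G A -> square_at z a w -> square_at z a (moebius A w) ->
    moebius A w = w.
  apply: square_at_injective => //; first by lra.
  by rewrite {1}yaE /k -/r; lra.
have := le_trans (square_mean_value_sqr cF a0 QH) (le_trans (unfolding
  (fuchsian_countable fG) cF mD DH Dcover (measurable_square_at z a) QH Qinj) FD).
rewrite lee_fin FL => mv.
have pi0 : 0 < pi :> R by exact: pi_gt0.
have step : Im z ^+ 2 * L <= (1 + k^-1) ^+ 2 / pi.
  have [->|Lneq] := eqVneq L 0.
    by rewrite mulr0 divr_ge0 ?sqr_ge0// ltW.
  have Lgt : 0 < L by rewrite lt_neqAle eq_sym Lneq.
  have h : pi * a ^+ 2 * L <= 1 by rewrite -(ler_pM2r Lgt) mul1r -[leLHS]mulrA -expr2.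
  rewrite ler_pdivlMr// (_ : _ * pi = (1 + k^-1) ^+ 2 * (pi * a ^+ 2 * L)).
    by rewrite -[leRHS]mulr1; apply: ler_wpM2l => //; exact: sqr_ge0.
  by rewrite /a; field; rewrite !gt_eqF.
apply: le_trans step _; rewrite -/S.
have S20 : 0 < S ^+ 2 by rewrite exprn_gt0.
have kS : (k ^+ 2)^-1 <= 9 / (16 * S ^+ 2).
  have -> : k ^+ 2 = 16 * (S ^+ 2 * C ^+ 2) / 9 by rewrite /k dbl; field.
  rewrite CS -[leRHS]invf_div; move: (S ^+ 2) S20 => s s0.
  have ss : 0 < s * (1 + s) by rewrite mulr_gt0// addr_gt0.
  rewrite lef_pV2 ?posrE; [|lra|lra].
  by have := mulr_gt0 s0 s0; lra.
have -> : 48 / pi + 4 / (3 * pi * S ^+ 2) = (48 + 4 / (3 * S ^+ 2)) / pi.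
  by rewrite [RHS]mulrDl -[4 / _ / pi]mulrA -invfM [3 * pi * _]mulrAC.
rewrite ler_pM2r ?invr_gt0//.
have sq : (1 + k^-1) ^+ 2 <= 2 + 2 * (k ^+ 2)^-1.
  by rewrite -exprVn; have := sqr_ge0 (1 - k^-1); lra.
have i0 : 0 < (S ^+ 2)^-1 by rewrite invr_gt0.
have tE : 4 / (3 * S ^+ 2) = 4 / 3 * (S ^+ 2)^-1 by rewrite invfM mulrA.
have kE : 9 / (16 * S ^+ 2) = 9 / 16 * (S ^+ 2)^-1 by rewrite invfM mulrA.
rewrite tE; rewrite kE in kS.
move: i0 kS sq; move: (S ^+ 2)^-1 (k ^+ 2)^-1 ((1 + k^-1) ^+ 2) => u v w.
by lra.
Qed.

End PointwiseBound.

Theorem theorem2p1 (R : realType) (Γ : psl2_subgroup R) (g : nat)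
    (D : set R[i]) (f : 'I_g -> R[i] -> R[i]) :
  fuchsian Γ -> torsion_free Γ -> cocompact Γ -> (2 <= g)%N ->
  fundamental_domain Γ D -> orthonormal_basis Γ D f ->
  forall z : R[i], upper_half_plane z ->
    bergman_kernel f z <=
      48 / pi + 4 / (3 * pi * sinh (injectivity_radius Γ / 4) ^+ 2).
Proof.
move=> fG tG cG _ fD [cf on _] z z0.
pose F w := \sum_(j < g) (f j z)^*%C * f j w.
pose L := \sum_(j < g) Normc.normc (f j z) ^+ 2.
have cF : cusp_form2 Γ F by exact: cusp_form_comb.
have L0 : 0 <= L by apply: sumr_ge0 => j _; exact: sqr_ge0.
have FL : Normc.normc (F z) = L.
  have -> : F z = (L%:C)%C.
    rewrite rmorph_sum; apply: eq_bigr => j _.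
    by rewrite mulrC -sqr_normc rmorphXn; congr (_ ^+ 2); exact: normC_normc.
  by rewrite /= expr0n addr0 sqrtr_sqr ger0_norm.
have -> : bergman_kernel f z = complex.Im z ^+ 2 * L by rewrite /bergman_kernel -mulr_sumr.
have [mD DH _ _] := fD; apply: norm_bound fG tG cG fD z0 cF L0 FL _; rewrite (orthonormal_norm (fun j => (f j z)^*%C) mD DH cf on).
rewrite lee_fin le_eqVlt; apply/orP; left; apply/eqP; apply: eq_bigr => j _.
by rewrite !sqr_normcE; case: (f j z) => ? ? /=; rewrite sqrrN.
Qed.
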